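(* Let $\Omega_1\subset\mathbb{R}^{d_1}$, $\Omega_2\subset\mathbb{R}^{d_2}$ be compact domains, $\Omega=\Omega_1\times\Omega_2$, $\gamma>0$, let $c\in L^2(\Omega)$ with $c\ge\underline{c}$ a.e. for some constant $\underline{c}>-\infty$, and let $\mu_i\in L^2(\Omega_i)$ with $\mu_i\ge\delta$ a.e. for some constant $\delta>0$ and $\int_{\Omega_i}\mu_i\,\mathrm{d}\lambda_i=1$, $i=1,2$. Then $\pi^*\in L^2(\Omega)$ is a solution of the quadratically regularized optimal transport problem $$\min_{\pi\in L^2(\Omega)}\ \int_\Omega c\,\pi\,\mathrm{d}\lambda+\tfrac\gamma2\|\pi\|_{L^2(\Omega)}^2\quad\text{s.t.}\quad \int_{\Omega_2}\pi\,\mathrm{d}\lambda_2=\mu_1\ \text{a.e. in }\Omega_1,\ \ \int_{\Omega_1}\pi\,\mathrm{d}\lambda_1=\mu_2\ \text{a.e. in }\Omega_2,\ \ \pi\ge0\ \text{a.e. in }\Omega$$ if and only if there exist functions $\alpha_i^*\in L^2(\Omega_i)$, $i=1,2$, such that $$\pi^*-\tfrac1\gamma(\alpha_1^*\oplus\alpha_2^*-c)_+=0\quad\lambda\text{-a.e. in }\Omega,$$ $$\int_{\Omega_2}(\alpha_1^*\oplus\alpha_2^*-c)_+\,\mathrm{d}\lambda_2=\gamma\mu_1\quad\lambda_1\text{-a.e. in }\Omega_1,$$ $$\int_{\Omega_1}(\alpha_1^*\oplus\alpha_2^*-c)_+\,\mathrm{d}\lambda_1=\gamma\mu_2\quad\lambda_2\text{-a.e.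 in }\Omega_2.$$
   Context: $\lambda_1,\lambda_2,\lambda$ denote Lebesgue measure on $\Omega_1,\Omega_2,\Omega$. A compact domain is understood as a compact set of positive Lebesgue measure. $x_+=\max(x,0)$. For functions $v_i$ on $\Omega_i$, $(v_1\oplus v_2)(x_1,x_2)=v_1(x_1)+v_2(x_2)$. *)

(* Defs.v *)
From HB Require Import structures.
From mathcomp Require Import all_boot all_order all_algebra.
From mathcomp Require Import all_classical all_reals all_analysis.

Set Implicit Arguments.
Unset Strict Implicit.
Unset Printing Implicit Defensive.
Import Order.TTheory GRing.Theory Num.Theory.
Import numFieldNormedType.Exports.

Local Open Scope classical_set_scope.
Local Open Scope ring_scope.

Definition measure_rV_display : measure_display -> measure_display.
Proof. exact. Qed.

(* The product sigma-algebra on row vectors, as the library does for tuples;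
   on 'rV[R]_n with R : realType it is the Borel sigma-algebra. *)
Section measurable_rV.
Context {d} {T : measurableType d} (n : nat).

Let coord_rV : 'I_n -> 'rV[T]_n -> T := fun i x => x ord0 i.

Let rV_set0 : g_sigma_preimage coord_rV set0.
Proof. exact: sigma_algebra0. Qed.

Let rV_setC A : g_sigma_preimage coord_rV A -> g_sigma_preimage coord_rV (~` A).
Proof. exact: sigma_algebraC. Qed.

Let rV_bigcup (F : _^nat) : (forall i, g_sigma_preimage coord_rV (F i)) ->
  g_sigma_preimage coord_rV (\bigcup_i (F i)).
Proof. exact: sigma_algebra_bigcup. Qed.

HB.instance Definition _ := @isMeasurable.Build (measure_rV_display d)
  'rV[T]_n (g_sigma_preimage coord_rV) rV_set0 rV_setC rV_bigcup.

Lemma measurable_coord_rV (i : 'I_n) :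
  measurable_fun [set: 'rV[T]_n] (fun x : 'rV[T]_n => x ord0 i).
Proof.
move=> _ Y mY; rewrite setTI; apply: sub_sigma_algebra => /=.
rewrite -bigcup_seq/=; exists i => /=; first by rewrite mem_index_enum.
by exists Y => //; rewrite setTI.
Qed.

Lemma measurable_fun_coord_rV d' (T' : measurableType d') (f : T' -> 'rV[T]_n) :
  (forall i, measurable_fun [set: T'] (fun x => f x ord0 i)) ->
  measurable_fun [set: T'] f.
Proof.
move=> mf _ A; rewrite setTI.
suff : g_sigma_preimage (fun i => coord_rV i \o f) `<=` measurable.
  rewrite g_sigma_preimage_comp => h mA; apply: h.
  by exists A => //; rewrite setTI.
apply: smallest_sub; first exact: sigma_algebra_measurable.
rewrite -bigcup_seq; apply: bigcup_sub => i _.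
by move=> B [C mC <-]; exact: mf.
Qed.

End measurable_rV.

(* Lebesgue measure on R^n, as the n-fold product of the Lebesgue measure on R:
   R^(n+1) is identified with R * R^n by splitting off the first coordinate. *)
Section lebesgue_rV.
Context {R : realType}.

Definition rV_cons n (z : measurableTypeR R * 'rV[R]_n) : 'rV[R]_n.+1 :=
  \row_i oapp (z.2 ord0) z.1 (unlift ord0 i).

Definition rV_uncons n (x : 'rV[R]_n.+1) : measurableTypeR R * 'rV[R]_n :=
  (x ord0 ord0, \row_i x ord0 (lift ord0 i)).

Lemma rV_consK n : cancel (@rV_cons n) (@rV_uncons n).
Proof.
case=> t x; rewrite /rV_uncons /rV_cons mxE unlift_none /=; congr pair.
by apply/rowP => i; rewrite !mxE liftK.
Qed.

Lemma measurable_rV_cons n : 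
  @measurable_fun _ _ (measurableTypeR R * 'rV[R]_n)%type 'rV[R]_n.+1 setT
    (@rV_cons n).
Proof.
apply: measurable_fun_coord_rV => i.
case: (unliftP ord0 i) => [j|] ->.
  rewrite [X in measurable_fun _ X](_ : _ =
    (fun x : 'rV[R]_n => x ord0 j) \o snd); last first.
    by apply/funext => z; rewrite mxE liftK.
  by apply: measurableT_comp => //; exact: measurable_coord_rV.
rewrite [X in measurable_fun _ X](_ : _ = fst); first exact: measurable_fst.
by apply/funext => z; rewrite mxE unlift_none.
Qed.

Lemma measurable_rV_uncons n : 
  @measurable_fun _ _ 'rV[R]_n.+1 (measurableTypeR R * 'rV[R]_n)%type setT
    (@rV_uncons n).
Proof.
apply/measurable_fun_pairP; split; first exact: (@measurable_coord_rV _ R).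
apply: measurable_fun_coord_rV => i.
rewrite [X in measurable_fun _ X](_ : _ =
  (fun x : 'rV[R]_n.+1 => x ord0 (lift ord0 i))); first exact: measurable_coord_rV.
by apply/funext => z; rewrite mxE.
Qed.

Section step.
Variables (n : nat) (m : {sigma_finite_measure set 'rV[R]_n -> \bar R}).

Definition lebesgue_rVS : set 'rV[R]_n.+1 -> \bar R :=
  pushforward (@lebesgue_measure R \x m)%E (@rV_cons n).

Let leb0 : lebesgue_rVS set0 = 0%E.
Proof. by rewrite /lebesgue_rVS /pushforward preimage_set0 measure0. Qed.

Let leb_ge0 A : (0 <= lebesgue_rVS A)%E.
Proof. by rewrite /lebesgue_rVS /pushforward measure_ge0. Qed.

Let leb_sigma_additive : semi_sigma_additive lebesgue_rVS.
Proof.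
move=> F mF tF mUF; rewrite /lebesgue_rVS /pushforward preimage_bigcup.
have mp A : measurable A ->
    @measurable _ (measurableTypeR R * 'rV[R]_n)%type (@rV_cons n @^-1` A).
  by move=> mA; rewrite -[X in measurable X]setTI; exact: measurable_rV_cons.
apply: measure_semi_sigma_additive.
- by move=> i; apply: (mp (F i)); exact: mF.
- apply/trivIsetP => /= i j _ _ ij; rewrite -preimage_setI.
  by move/trivIsetP : tF => /(_ _ _ _ _ ij) ->//; rewrite preimage_set0.
- by rewrite -preimage_bigcup; exact: mp.
Qed.

HB.instance Definition _ := isMeasure.Build _ _ _
  lebesgue_rVS leb0 leb_ge0 leb_sigma_additive.

Let leb_sigma_finite : sigma_finite setT lebesgue_rVS.
Proof.
have /sigma_finiteP[F [TF ndF Foo]] := sigma_finiteT (@lebesgue_measure R).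
have /sigma_finiteP[G [TG ndG Goo]] := sigma_finiteT m.
exists (fun k => @rV_uncons n @^-1` (F k `*` G k)).
  apply/esym; rewrite -subTset => z _.
  have [i _ Fi] : (\bigcup_k F k) (rV_uncons z).1 by rewrite -TF.
  have [j _ Gj] : (\bigcup_k G k) (rV_uncons z).2 by rewrite -TG.
  exists (maxn i j) => //; split.
  - by move: Fi; exact/subsetPset/ndF/leq_maxl.
  - by move: Gj; exact/subsetPset/ndG/leq_maxr.
move=> k; have [mF Fk] := Foo k; have [mG Gk] := Goo k; split.
  rewrite -[X in measurable X]setTI; apply: measurable_rV_uncons => //.
  exact: measurableX.
rewrite /lebesgue_rVS /pushforward -comp_preimage.
rewrite (_ : _ \o _ = id) ?preimage_id; last by apply/funext => z; exact: rV_consK.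
by rewrite product_measure1E// lte_mul_pinfty// ge0_fin_numE.
Qed.

HB.instance Definition _ := Measure_isSigmaFinite.Build _ _ _
  lebesgue_rVS leb_sigma_finite.

End step.

Fixpoint lebesgue_rV n : {sigma_finite_measure set 'rV[R]_n -> \bar R} :=
  match n with
  | 0 => \d_(0 : 'rV[R]_0)
  | n.+1 => lebesgue_rVS (lebesgue_rV n)
  end.

End lebesgue_rV.
Arguments lebesgue_rV R n : clear implicits.

Lemma lebesgue_rV_box (R : realType) n (A : 'I_n -> set (measurableTypeR R)) :
  (forall i, measurable (A i)) ->
  lebesgue_rV R n [set x | forall i, A i (x ord0 i)] =
  (\prod_(i < n) lebesgue_measure (A i))%E.
Proof.
elim: n A => [|n IH] A mA.
  by rewrite big_ord0 /= diracE mem_set// => -[].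
rewrite big_ord_recl -IH//.
transitivity ((lebesgue_measure \x lebesgue_rV R n)%E
  (A ord0 `*` [set x : 'rV[R]_n | forall i, A (lift ord0 i) (x ord0 i)])).
  rewrite /= /lebesgue_rVS /pushforward; congr (_ _); apply/seteqP; split => -[t x] /=.
    move=> H; split => /=.
      by have := H ord0; rewrite mxE unlift_none.
    by move=> i; have := H (lift ord0 i); rewrite mxE liftK.
  move=> [H1 H2] i; rewrite mxE; case: (unliftP ord0 i) => [j|] -> /=.
    exact: H2.
  exact: H1.
rewrite product_measure1E//.
rewrite [X in measurable X](_ : _ = \bigcap_(i in [set: 'I_n])
  ((fun x : 'rV[R]_n => x ord0 i) @^-1` A (lift ord0 i))).
  apply: fin_bigcap_measurable => // i _; rewrite -[X in measurable X]setTI.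
  by apply: measurable_coord_rV => //; exact: mA.
by apply/seteqP; split => x /= H i; [move=> _|]; apply: H.
Qed.

Section L2.
Context {R : realType} {d} {T : measurableType d}.
Variables (mu : {measure set T -> \bar R}) (D : set T).

(* Elements of L^2(D) are represented by total functions, only their values on
   D being relevant: f \_ D is the extension by 0 of the restriction to D. *)
Definition L2 (f : T -> R) : Prop := f \_ D \in Lfun mu 2%:E.

Definition L2norm (f : T -> R) : R := fine ('N[mu]_2%:E[EFin \o (f \_ D)])%E.

End L2.

Definition compact_domain {R : realType} {n} (Omega : set 'rV[R]_n) : Prop :=
  compact Omega /\ (0 < lebesgue_rV R n Omega)%E.

Definition oplus {R : realType} {T1 T2 : Type} (v1 : T1 -> R) (v2 : T2 -> R) :
  T1 * T2 -> R := fun x => v1 x.1 + v2 x.2.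

Definition pos_part {R : realType} (x : R) : R := Num.max x 0.

(* R^(d1 + d2) is identified with R^d1 * R^d2. *)
Definition lebesgue_prod (R : realType) (d1 d2 : nat) :
    {measure set ('rV[R]_d1 * 'rV[R]_d2) -> \bar R} :=
  (lebesgue_rV R d1 \x lebesgue_rV R d2)%E.

Section quadratically_regularized_optimal_transport.
Context {R : realType} {d1 d2 : nat}.
Variables (Omega1 : set 'rV[R]_d1) (Omega2 : set 'rV[R]_d2).
Local Notation Omega := (Omega1 `*` Omega2).
Local Notation lambda1 := (lebesgue_rV R d1).
Local Notation lambda2 := (lebesgue_rV R d2).
Local Notation lambda := (lebesgue_prod R d1 d2).
Implicit Types f pi c : 'rV[R]_d1 * 'rV[R]_d2 -> R.

Definition marginal1_eq f (mu1 : 'rV[R]_d1 -> R) : Prop :=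
  {ae lambda1, forall x1, Omega1 x1 ->
    (\int[lambda2]_(x2 in Omega2) (f (x1, x2))%:E = (mu1 x1)%:E)%E}.

Definition marginal2_eq f (mu2 : 'rV[R]_d2 -> R) : Prop :=
  {ae lambda2, forall x2, Omega2 x2 ->
    (\int[lambda1]_(x1 in Omega1) (f (x1, x2))%:E = (mu2 x2)%:E)%E}.

Definition qrot_feasible (mu1 : 'rV[R]_d1 -> R) (mu2 : 'rV[R]_d2 -> R) pi :
    Prop :=
  [/\ L2 lambda Omega pi,
      marginal1_eq pi mu1,
      marginal2_eq pi mu2 &
      {ae lambda, forall x, Omega x -> 0 <= pi x}].

Definition qrot_objective (gamma : R) c pi : R :=
  \int[lambda]_(x in Omega) (c x * pi x)
  + gamma / 2 * L2norm lambda Omega pi ^+ 2.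

Definition qrot_solution (gamma : R) c (mu1 : 'rV[R]_d1 -> R)
    (mu2 : 'rV[R]_d2 -> R) pi : Prop :=
  qrot_feasible mu1 mu2 pi /\
  forall pi', qrot_feasible mu1 mu2 pi' ->
    qrot_objective gamma c pi <= qrot_objective gamma c pi'.

End quadratically_regularized_optimal_transport.

(* Main.v *)
Require Import Defs.
From mathcomp Require Import all_boot all_order all_algebra.
From mathcomp Require Import all_classical all_reals all_analysis.
From mathcomp Require Import measurable_realfun ring lra.

Set Implicit Arguments.
Unset Strict Implicit.
Unset Printing Implicit Defensive.
Import Order.TTheory GRing.Theory Num.Theory.
Import numFieldNormedType.Exports.

Local Open Scope classical_set_scope.
Local Open Scope ring_scope.

(* Write the potentials as [alpha1 = a] and [alpha2 = - b], so that the dual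
   integrand is a convex function of [a x - b y - c (x, y)].  Three facts about
   the dual functional give a minimizer without weak compactness:
   - pairing the potentials with the feasible plan [mu1 (x) mu2] makes the
     integrand nonnegative and controls the L^1 norm of [a x - b y];
   - a convex function of [a - b] is submodular in [(a, b)], so replacing two
     almost minimizers by their pointwise maximum only adds up their defects;
   - when [b] has mean zero, [a] may be cut off from above at a fixed L^2
     function without increasing the functional.
   Hence the pointwise limit superior of a fast minimizing sequence is a.e.
   finite and, by Fatou, a minimizer.  Perturbing it by signs of the residuals
   yields the two marginal equations, and these bound the potentials from below
   by a constant and from above by an L^2 function.
   Conversely, if [p = (alpha1 (+) alpha2 - c)_+ / gamma] is feasible, then every
   feasible [q] costs at least [gamma / 2 |q - p|^2] more than [p]; this gives
   the sufficiency, and identifies any given solution with the one built from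
   the dual minimizer. *)

(** * The dual integrand *)

Section dual_integrand.
Context {R : realType}.
Implicit Types a b c h k t u v x y : R.

(** Up to the constant [k ^+ 2 / 2] this is the convex function [pos_part t ^+ 2 / 2 - k * t]; the
    square is completed so that nonnegativity for [0 <= k] is visible. *)
Definition dual_integrand k t : R := (pos_part t - k) ^+ 2 / 2 + k * pos_part (- t).

Lemma pos_partP t : (0 <= t /\ pos_part t = t) \/ (t <= 0 /\ pos_part t = 0).
Proof.
rewrite /pos_part; case: (leP 0 t) => [t0|/ltW t0]; [left|right]; split => //.
Qed.

Lemma ge0_pos_part t : 0 <= t -> pos_part t = t.
Proof. by move=> ?; apply/max_idPl. Qed.

Lemma le0_pos_part t : t <= 0 -> pos_part t = 0.
Proof. by move=> ?; apply/max_idPr. Qed.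

Lemma pos_part_ge0 t : 0 <= pos_part t.
Proof. by rewrite /pos_part le_max lexx orbT. Qed.

Lemma pos_part_ge t : t <= pos_part t.
Proof. by rewrite /pos_part le_max lexx. Qed.

Lemma pos_part_le t h : t <= h -> pos_part t <= pos_part h.
Proof. by move=> th; rewrite /pos_part ge_max !le_max th lexx orbT. Qed.

Lemma pos_part_norm t : pos_part t <= `|t|.
Proof. by rewrite /pos_part ge_max ler_norm normr_ge0. Qed.

Lemma pos_partN t : pos_part (- t) = pos_part t - t.
Proof.
by have [[? ->]|[? ->]] := pos_partP t; have [[? ->]|[? ->]] := pos_partP (- t); lra.
Qed.

Lemma dual_integrandE k t :
  dual_integrand k t = pos_part t ^+ 2 / 2 - k * t + k ^+ 2 / 2.
Proof.
by rewrite /dual_integrand pos_partN; field.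
Qed.

Lemma dual_integrand_ge0 k t : 0 <= k -> 0 <= dual_integrand k t.
Proof.
by move=> k0; rewrite addr_ge0// ?divr_ge0 ?sqr_ge0// mulr_ge0// pos_part_ge0.
Qed.

(** The pairs [(u, v)] and [(x, y)] have the same sum and the first lies inside the interval spanned
    by the second, so convexity of the squared positive part applies. *)
Lemma pos_part_sqr_convex x y u v : x <= u -> u <= y -> u + v = x + y ->
  pos_part u ^+ 2 + pos_part v ^+ 2 <= pos_part x ^+ 2 + pos_part y ^+ 2.
Proof.
move=> xu uy uv.
have {uv} -> : v = x + y - u by lra.
have [[? ->]|[? ->]] := pos_partP u; have [[? ->]|[? ->]] := pos_partP (x + y - u);
have [[? ->]|[? ->]] := pos_partP x; have [[? ->]|[? ->]] := pos_partP y; nra.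
Qed.

(** If both pairs are ordered alike, the two sides agree. Otherwise the new arguments lie between
    the old ones and have the same sum: the affine parts agree and [pos_part_sqr_convex] handles the
    squares. *)
Lemma dual_integrand_submodular k a a' b b' c :
  dual_integrand k (Num.max a a' - Num.max b b' - c) +
  dual_integrand k (Num.min a a' - Num.min b b' - c) <=
  dual_integrand k (a - b - c) + dual_integrand k (a' - b' - c).
Proof.
rewrite !dual_integrandE.
case: (leP a a') => [aa'|/ltW aa']; case: (leP b b') => [bb'|/ltW bb'].
- lra.
- have := @pos_part_sqr_convex (a - b - c) (a' - b' - c) (a' - b - c) (a - b' - c).
  by move=> /(_ ltac:(lra) ltac:(lra) ltac:(lra)); lra.
- have := @pos_part_sqr_convex (a' - b' - c) (a - b - c) (a - b' - c) (a' - b - c).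
  by move=> /(_ ltac:(lra) ltac:(lra) ltac:(lra)); lra.
- lra.
Qed.

(** The derivative in [t] is [pos_part t - k], which is 1-Lipschitz; hence the quadratic
    remainder. *)
Lemma dual_integrand_le k t h : dual_integrand k (t + h) <=
  dual_integrand k t + (pos_part t - k) * h + h ^+ 2 / 2.
Proof.
rewrite !dual_integrandE.
have [[? ->]|[? ->]] := pos_partP t; have [[? ->]|[? ->]] := pos_partP (t + h); nra.
Qed.

(** Tangent-line inequality of convexity, with the same derivative. *)
Lemma dual_integrand_ge k t h :
  dual_integrand k t + (pos_part t - k) * h <= dual_integrand k (t + h).
Proof.
rewrite !dual_integrandE.
have [[? ->]|[? ->]] := pos_partP t; have [[? ->]|[? ->]] := pos_partP (t + h); nra.
Qed.

(** For [t >= 0] the growth is quadratic; for [t < 0] it is linear with slope [- k <= - e], so the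
    positive lower bound on [k] controls the negative side. *)
Lemma dual_integrand_coercive e k t : 0 < e -> e <= k ->
  `|t| <= (4 + e^-1) * dual_integrand k t + (1 + 2 * k ^+ 2).
Proof.
move=> e0 ek.
have k0 : 0 <= k by lra.
have G0 := dual_integrand_ge0 t k0.
have eG0 : 0 <= e^-1 * dual_integrand k t by rewrite mulr_ge0// invr_ge0 ltW.
have [t0|t0] := leP 0 t.
  move: eG0; rewrite ger0_norm// mulrDl; set X := e^-1 * _ => X0.
  rewrite /dual_integrand pos_partN ge0_pos_part// subrr mulr0 addr0.
  by have := sqr_ge0 (t - 1 / 2); have := sqr_ge0 (t - 2 * k); nra.
have tG : - t <= e^-1 * dual_integrand k t.
  rewrite ler_pdivlMl// /dual_integrand pos_partN (le0_pos_part (ltW t0)).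
  nra.
rewrite ltr0_norm// mulrDl; nra.
Qed.

Lemma pos_part_sqr_coercive k t : 0 <= k ->
  pos_part t ^+ 2 <= 4 * dual_integrand k t + 2 * k ^+ 2.
Proof.
(* For [t >= 0] the gap between the two sides is exactly this square. *)
move=> k0; rewrite /dual_integrand pos_partN; have := sqr_ge0 (t - 2 * k).
by have [[? ->]|[? ->]] := pos_partP t; nra.
Qed.

Lemma cvg_dual_integrand k t (u : R^nat) : u @ \oo --> t ->
  dual_integrand k (u n) @[n --> \oo] --> dual_integrand k t.
Proof.
move=> ut.
have pp (v : R^nat) s : v @ \oo --> s -> pos_part (v n) @[n --> \oo] --> pos_part s.
  move=> vs; under eq_fun do rewrite /pos_part maxr_absE subr0 addr0.
  rewrite /pos_part maxr_absE subr0 addr0; apply: cvgM; last exact: cvg_cst.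
  by apply: cvgD => //; exact: cvg_norm.
apply: cvgD; last first.
  by apply: cvgM; [exact: cvg_cst|apply: pp; exact: cvgN].
apply: cvgM; last exact: cvg_cst.
rewrite expr2; under eq_fun do rewrite expr2.
by apply: cvgM; apply: cvgB; (exact: pp || exact: cvg_cst).
Qed.

End dual_integrand.

(** * Real-valued integrals *)

Section real_integrals.
Context d (T : measurableType d) (R : realType).
Variable m : {measure set T -> \bar R}.
Implicit Types f g : T -> R.

Definition rintegrable f := m.-integrable setT (EFin \o f).

Lemma measurable_rintegrable f : rintegrable f -> measurable_fun setT f.
Proof. by move=> /measurable_int /measurable_EFinP. Qed.

Lemma rintegrableD f g : rintegrable f -> rintegrable g ->
  rintegrable (fun x => f x + g x).
Proof. by move=> If Ig; exact: (integrableD measurableT If Ig). Qed.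

Lemma rintegrableN f : rintegrable f -> rintegrable (fun x => - f x).
Proof. by move=> If; exact: (integrableN If). Qed.

Lemma rintegrableB f g : rintegrable f -> rintegrable g ->
  rintegrable (fun x => f x - g x).
Proof. by move=> If Ig; exact: (integrableB measurableT If Ig). Qed.

Lemma rintegrableZ k f : rintegrable f -> rintegrable (fun x => k * f x).
Proof. by move=> If; exact: (integrableZl measurableT k If). Qed.

Lemma rintegrable_norm f : rintegrable f -> rintegrable (fun x => `|f x|).
Proof. by move=> If; exact: (integrable_norm If). Qed.

Lemma rintegrable_dom f g : measurable_fun setT f -> rintegrable g ->
  (forall x, `|f x| <= g x) -> rintegrable f.
Proof.
move=> mf Ig fg; apply: (le_integrable measurableT _ _ Ig).
  exact/measurable_EFinP.
by move=> x _ /=; rewrite lee_fin (le_trans (fg x))// ler_norm.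
Qed.

Lemma ge0_rintegrableP f : measurable_fun setT f -> (forall x, 0 <= f x) ->
  rintegrable f <-> (\int[m]_x (f x)%:E < +oo)%E.
Proof.
move=> mf f0; split => [If|If].
  exact: (integrable_lty measurableT If).
apply/integrableP; split; first exact/measurable_EFinP.
by under eq_integral do rewrite /= ger0_norm//.
Qed.

Lemma RintegralE_EFin f : rintegrable f ->
  (\int[m]_x (f x)%:E)%E = (\int[m]_x f x)%:E.
Proof. by move=> If; rewrite /Rintegral fineK//; exact: integrable_fin_num. Qed.

Lemma Rint_D f g : rintegrable f -> rintegrable g ->
  \int[m]_x (f x + g x) = \int[m]_x f x + \int[m]_x g x.
Proof. by move=> If Ig; exact: RintegralD. Qed.

Lemma Rint_B f g : rintegrable f -> rintegrable g ->
  \int[m]_x (f x - g x) = \int[m]_x f x - \int[m]_x g x.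
Proof. by move=> If Ig; exact: RintegralB. Qed.

Lemma Rint_Z k f : rintegrable f -> \int[m]_x (k * f x) = k * \int[m]_x f x.
Proof. by move=> If; exact: RintegralZl. Qed.

Lemma Rint_N f : rintegrable f -> \int[m]_x (- f x) = - \int[m]_x f x.
Proof.
move=> If; rewrite -mulN1r -Rint_Z//; apply: eq_Rintegral => x _.
by rewrite mulN1r.
Qed.

Lemma ae_eq_Rint f g : measurable_fun setT f -> measurable_fun setT g ->
  {ae m, forall x, f x = g x} -> \int[m]_x f x = \int[m]_x g x.
Proof.
move=> mf mg fg; congr fine; apply: ae_eq_integral => //; try exact/measurable_EFinP.
by apply: filterS fg => x /= -> .
Qed.

Lemma ae_rintegrable f g : measurable_fun setT g ->
  {ae m, forall x, f x = g x} -> rintegrable f -> rintegrable g.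
Proof.
move=> mg fg If.
have mf := measurable_rintegrable If.
apply/integrableP; split; first exact/measurable_EFinP.
move/integrableP : If => [_]; apply: le_lt_trans.
rewrite le_eqVlt; apply/orP; left; apply/eqP; apply: ae_eq_integral => //.
- exact/measurableT_comp/measurable_EFinP.
- exact/measurableT_comp/measurable_EFinP.
- by apply: filterS fg => x /= -> .
Qed.

Lemma ae_le_Rint f g : rintegrable f -> rintegrable g ->
  {ae m, forall x, f x <= g x} -> \int[m]_x f x <= \int[m]_x g x.
Proof.
move=> If Ig fg.
have mf := measurable_rintegrable If.
have mg := measurable_rintegrable Ig.
(* Replacing [g] by [max f g], equal to it a.e., turns the a.e. inequality into a pointwise one. *)
have mM : measurable_fun setT (fun x => Num.max (f x) (g x)) by exact: measurable_maxr.
have aeM : {ae m, forall x, g x = Num.max (f x) (g x)}.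
  by apply: filterS fg => x /max_idPr ->.
rewrite (ae_eq_Rint mg mM aeM); apply: le_Rintegral => //.
  exact: (ae_rintegrable mM aeM Ig).
by move=> x _; rewrite le_max lexx.
Qed.

Lemma le_Rint f g : rintegrable f -> rintegrable g ->
  (forall x, f x <= g x) -> \int[m]_x f x <= \int[m]_x g x.
Proof. by move=> If Ig fg; apply: ae_le_Rint => //; exact: aeW. Qed.

Lemma ge0_Rint_eq0 f : rintegrable f -> (forall x, 0 <= f x) ->
  \int[m]_x f x = 0 -> {ae m, forall x, f x = 0}.
Proof.
move=> If f0 f00.
have : (\int[m]_x `|(EFin \o f) x| = 0)%E.
  under eq_integral do rewrite gee0_abs ?lee_fin//.
  by rewrite RintegralE_EFin// f00.
move/ae_eq_integral_abs => /(_ measurableT (measurable_int _ If)).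
by apply: filterS => x /(_ I) [].
Qed.

Definition sqintegrable f :=
  measurable_fun setT f /\ rintegrable (fun x => f x ^+ 2).

Lemma sqintegrable_dom f g : measurable_fun setT f -> rintegrable g ->
  (forall x, f x ^+ 2 <= g x) -> sqintegrable f.
Proof.
move=> mf Ig fg; split => //; apply: (rintegrable_dom _ Ig).
  exact: measurable_funX.
by move=> x; rewrite ger0_norm ?sqr_ge0.
Qed.

Lemma sqintegrableM f g : sqintegrable f -> sqintegrable g ->
  rintegrable (fun x => f x * g x).
Proof.
move=> [mf If] [mg Ig]; apply: (rintegrable_dom _ (rintegrableD If Ig)).
  exact: measurable_funM.
move=> x; rewrite normrM.
rewrite -(real_normK (num_real (f x))) -(real_normK (num_real (g x))).
by have := sqr_ge0 (`|f x| - `|g x|); nra.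
Qed.

Lemma sqintegrableD f g : sqintegrable f -> sqintegrable g ->
  sqintegrable (fun x => f x + g x).
Proof.
move=> [mf If] [mg Ig].
apply: (sqintegrable_dom _ (rintegrableZ 2 (rintegrableD If Ig))).
  exact: measurable_funD.
by move=> x; have := sqr_ge0 (f x - g x); nra.
Qed.

Lemma sqintegrableZ k f : sqintegrable f -> sqintegrable (fun x => k * f x).
Proof.
move=> [mf If].
apply: (sqintegrable_dom _ (rintegrableZ (k ^+ 2) If)).
  exact: measurable_funM.
by move=> x; rewrite exprMn.
Qed.

Lemma sqintegrableN f : sqintegrable f -> sqintegrable (fun x => - f x).
Proof.
by move=> /(sqintegrableZ (-1)) /=; under eq_fun do rewrite mulN1r.
Qed.

Lemma sqintegrableB f g : sqintegrable f -> sqintegrable g ->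
  sqintegrable (fun x => f x - g x).
Proof. by move=> Lf /sqintegrableN Lg; exact: sqintegrableD. Qed.

Lemma sqintegrable_pos_part f : sqintegrable f ->
  sqintegrable (fun x => pos_part (f x)).
Proof.
move=> [mf If]; apply: (sqintegrable_dom _ If); first exact: measurable_maxr.
by move=> x; have [[? ->]|[? ->]] := pos_partP (f x); nra.
Qed.

Lemma ae_sqintegrable f g : measurable_fun setT g ->
  {ae m, forall x, f x = g x} -> sqintegrable f -> sqintegrable g.
Proof.
move=> mg fg [mf If]; split => //; apply: (ae_rintegrable _ _ If).
  exact: measurable_funX.
by apply: filterS fg => x ->.
Qed.

End real_integrals.

(** * Integrals over a finite measure *)

Section finite_measure_integrals.
Context d (T : measurableType d) (R : realType).
Variable m : {finite_measure set T -> \bar R}.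
Implicit Types f g : T -> R.

Lemma rintegrable_cst (k : R) : rintegrable m (fun=> k).
Proof. exact: (finite_measure_integrable_cst m k measurableT). Qed.

Lemma Rint_cst (k : R) : \int[m]_x k = k * fine (m setT).
Proof. by rewrite (@Rintegral_cst _ _ _ m setT). Qed.

Lemma sqintegrable_cst (k : R) : sqintegrable m (fun=> k).
Proof. by split => //; exact: rintegrable_cst. Qed.

Lemma sqintegrable_rintegrable f : sqintegrable m f -> rintegrable m f.
Proof.
move=> Lf; have := sqintegrableM Lf (sqintegrable_cst 1).
by congr rintegrable; apply/funext => x; rewrite mulr1.
Qed.

(** Cauchy-Schwarz against the constant 1, obtained from the nonnegativity of the integrated squared
    deviation from the mean. *)
Lemma sqr_Rint_le f : 0 < fine (m setT) -> sqintegrable m f ->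
  (\int[m]_x f x) ^+ 2 <= fine (m setT) * \int[m]_x (f x ^+ 2).
Proof.
move=> m0 Lf; have [_ If2] := Lf; have If := sqintegrable_rintegrable Lf.
set M := fine _ in m0 *; set I := \int[m]_x f x; pose mean := I / M.
have : 0 <= \int[m]_x (f x ^+ 2 - 2 * mean * f x + mean ^+ 2).
  by apply: Rintegral_ge0 => x _; have := sqr_ge0 (f x - mean); nra.
rewrite Rint_D; [|by apply: rintegrableB => //; exact: rintegrableZ
                 |exact: rintegrable_cst].
rewrite Rint_B//; last exact: rintegrableZ.
rewrite Rint_Z// Rint_cst -/M -/I.
move=> H; have MI : M * mean = I by rewrite /mean mulrC divfK ?gt_eqF.
have := mulr_ge0 (ltW m0) H; rewrite -MI; nra.
Qed.

Lemma finite_mass_gt0 f : measurable_fun setT f -> \int[m]_x f x = 1 -> 0 < fine (m setT).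
Proof.
move=> mf f_1; rewrite lt_neqAle fine_ge0// andbT eq_sym; apply/eqP => m0.
suff : \int[m]_x f x = 0 by rewrite f_1 => /eqP; rewrite oner_eq0.
have -> : \int[m]_x f x = \int[m]_x (0 : R).
  apply: ae_eq_Rint => //; exists setT; split => //.
  by rewrite -[LHS]fineK ?m0//; exact: fin_num_measure.
by rewrite Rint_cst mul0r.
Qed.

End finite_measure_integrals.

(** * Sections and Fubini for a product of finite measures *)

Section product_integrals.
Context d1 d2 (X : measurableType d1) (Y : measurableType d2) (R : realType).
Variables (mu : {finite_measure set X -> \bar R})
  (nu : {finite_measure set Y -> \bar R}).
Local Notation P := (mu \x nu)%E.
Implicit Types (f : X -> R) (g : Y -> R) (w : X * Y -> R).

Lemma measurable_section1 w x : measurable_fun setT w ->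
  measurable_fun setT (fun y => w (x, y)).
Proof. by move=> mw; exact: measurableT_comp. Qed.

Lemma measurable_section2 w y : measurable_fun setT w ->
  measurable_fun setT (fun x => w (x, y)).
Proof. by move=> mw; exact: measurableT_comp. Qed.

(** The product measure of the exceptional set is the integral of the measures of its sections, so
    almost all sections are null. *)
Lemma ae_section1 (Q : X * Y -> Prop) : {ae P, forall z, Q z} ->
  {ae mu, forall x, {ae nu, forall y, Q (x, y)}}.
Proof.
move=> [N [mN N0 QN]].
have /ae_eq_integral_abs H : (\int[mu]_x `|(nu \o xsection N) x| = 0)%E.
  by under eq_integral do rewrite gee0_abs ?measure_ge0//.
have {}H := (H measurableT (measurable_fun_xsection nu mN)).
apply: filterS H => x /(_ I) /= H.
exists (xsection N x); split => //; first exact: measurable_xsection.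
by move=> y; rewrite /xsection /= inE => nQ; exact: QN.
Qed.

Lemma ae_section2 (Q : X * Y -> Prop) : {ae P, forall z, Q z} ->
  {ae nu, forall y, {ae mu, forall x, Q (x, y)}}.
Proof.
move=> [N [mN N0 QN]].
(* The product measure is defined through [x]-sections; by uniqueness it agrees with the one defined
   through [y]-sections. *)
have N0' : (mu \x^ nu)%E N = 0%E.
  rewrite -N0; apply/esym; apply: product_measure_unique => // A B mA mB.
  exact: product_measure2E.
have /ae_eq_integral_abs H : (\int[nu]_y `|(mu \o ysection N) y| = 0)%E.
  by under eq_integral do rewrite gee0_abs ?measure_ge0//.
have {}H := (H measurableT (measurable_fun_ysection mu mN)).
apply: filterS H => y /(_ I) /= H.
exists (ysection N y); split => //; first exact: measurable_ysection.
by move=> x; rewrite /ysection /= inE => nQ; exact: QN.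
Qed.

Lemma rintegrable_section1 w : rintegrable P w ->
  {ae mu, forall x, rintegrable nu (fun y => w (x, y))}.
Proof. exact: ae_integrable1. Qed.

Lemma rintegrable_section2 w : rintegrable P w ->
  {ae nu, forall y, rintegrable mu (fun x => w (x, y))}.
Proof. exact: ae_integrable2. Qed.

Lemma rintegrable_Rint1 w : rintegrable P w ->
  rintegrable mu (fun x => \int[nu]_y w (x, y)).
Proof.
move=> Iw; have IF := integrable_fubini_F Iw.
have mF : measurable_fun setT (fun x => \int[nu]_y w (x, y)).
  by apply: (measurableT_comp (fine_measurable measurableT)); exact: measurable_int IF.
apply/integrableP; split; first exact/measurable_EFinP.
move/integrableP : (IF) => [mIF]; apply: le_lt_trans.
apply: ge0_le_integral => //; [exact/measurableT_comp/measurable_EFinP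
  |exact: measurableT_comp|].
(* [fine] sends an infinite section integral to 0, so passing to real values never increases the
   absolute value. *)
move=> x _ /=; rewrite /Rintegral /fubini_F /=.
by case: (integral _ _ _) => //= *; rewrite ?leey ?normr0.
Qed.

Lemma Rint_fubini1 w : rintegrable P w ->
  \int[P]_z w z = \int[mu]_x \int[nu]_y w (x, y).
Proof.
move=> Iw; rewrite [LHS]/Rintegral -(integral12_prod_meas1 Iw); congr fine.
apply: ae_eq_integral => //.
- exact: measurable_int (integrable_fubini_F Iw).
- exact: measurable_int (rintegrable_Rint1 Iw).
- apply: filterS (rintegrable_section1 Iw) => x If _.
  exact: RintegralE_EFin.
Qed.

Lemma rintegrable_swap w : rintegrable P w ->
  rintegrable (nu \x mu)%E (fun z => w (z.2, z.1)).
Proof.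
move=> Iw; have mw := measurable_rintegrable Iw.
have mw' : measurable_fun [set: Y * X] (EFin \o (fun z : Y * X => w (z.2, z.1))).
  apply/measurable_EFinP; apply: (measurableT_comp mw).
  exact: measurable_fun_pair.
apply/integrable12ltyP => //=.
have [+ _] := @integrable21ltyP _ _ _ _ _ mu nu (EFin \o w)
  ((measurable_EFinP _ _).2 mw).
by apply.
Qed.

End product_integrals.

Section product_integrals2.
Context d1 d2 (X : measurableType d1) (Y : measurableType d2) (R : realType).
Variables (mu : {finite_measure set X -> \bar R})
  (nu : {finite_measure set Y -> \bar R}).
Local Notation P := (mu \x nu)%E.
Implicit Types (f : X -> R) (g : Y -> R) (w : X * Y -> R).

Lemma rintegrable_Rint2 w : rintegrable P w ->
  rintegrable nu (fun y => \int[mu]_x w (x, y)).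
Proof. by move/rintegrable_swap/rintegrable_Rint1. Qed.

Lemma Rint_fubini2 w : rintegrable P w ->
  \int[P]_z w z = \int[nu]_y \int[mu]_x w (x, y).
Proof.
move=> Iw; rewrite [LHS]/Rintegral -(integral21_prod_meas1 Iw).
have /= <- := Rint_fubini1 (rintegrable_swap Iw).
rewrite /Rintegral -(integral12_prod_meas1 (rintegrable_swap Iw)).
by congr fine.
Qed.

Lemma rintegrable_tensor f g : rintegrable mu f -> rintegrable nu g ->
  rintegrable P (fun z => f z.1 * g z.2).
Proof.
move=> If Ig; have mf := measurable_rintegrable If.
have mg := measurable_rintegrable Ig.
apply/integrable12ltyP => /=.
  by apply/measurable_EFinP; apply: measurable_funM; exact: measurableT_comp.
under eq_integral => x _.
  under eq_integral do rewrite normrM EFinM.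
  rewrite ge0_integralZl//; last exact/measurable_EFinP/measurableT_comp.
  rewrite (RintegralE_EFin (rintegrable_norm Ig)) -EFinM mulrC.
  over.
exact: (integrable_lty measurableT (rintegrableZ _ (rintegrable_norm If))).
Qed.

Lemma Rint_tensor f g : rintegrable mu f -> rintegrable nu g ->
  \int[P]_z (f z.1 * g z.2) = (\int[mu]_x f x) * (\int[nu]_y g y).
Proof.
move=> If Ig; rewrite Rint_fubini1 /=; last exact: rintegrable_tensor.
under eq_Rintegral do rewrite Rint_Z// mulrC.
by rewrite Rint_Z// mulrC.
Qed.

Lemma rintegrable_fst f : rintegrable mu f -> rintegrable P (fun z => f z.1).
Proof.
move=> If; have := rintegrable_tensor If (rintegrable_cst nu 1).
by under eq_fun do rewrite mulr1.
Qed.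

Lemma rintegrable_snd g : rintegrable nu g -> rintegrable P (fun z => g z.2).
Proof.
move=> Ig; have := rintegrable_tensor (rintegrable_cst mu 1) Ig.
by under eq_fun do rewrite mul1r.
Qed.

Lemma rintegrable_prod_cst (k : R) : rintegrable P (fun=> k).
Proof. exact: (rintegrable_fst (rintegrable_cst mu k)). Qed.

Lemma Rint_fst f : rintegrable mu f ->
  \int[P]_z f z.1 = (\int[mu]_x f x) * fine (nu setT).
Proof.
move=> If; have := Rint_tensor If (rintegrable_cst nu 1).
by rewrite Rint_cst mul1r => <-; apply: eq_Rintegral => z _; rewrite mulr1.
Qed.

Lemma Rint_snd g : rintegrable nu g ->
  \int[P]_z g z.2 = (\int[nu]_y g y) * fine (mu setT).
Proof.
move=> Ig; have := Rint_tensor (rintegrable_cst mu 1) Ig.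
by rewrite Rint_cst mul1r mulrC => <-; apply: eq_Rintegral => z _; rewrite mul1r.
Qed.

Lemma sqintegrable_tensor f g : sqintegrable mu f -> sqintegrable nu g ->
  sqintegrable P (fun z => f z.1 * g z.2).
Proof.
move=> [mf If] [mg Ig]; apply: (sqintegrable_dom _ (rintegrable_tensor If Ig)).
  by apply: measurable_funM; exact: measurableT_comp.
by move=> z; rewrite exprMn.
Qed.

Lemma sqintegrable_fst f : sqintegrable mu f -> sqintegrable P (fun z => f z.1).
Proof.
move=> Lf; have := sqintegrable_tensor Lf (sqintegrable_cst nu 1).
by under eq_fun do rewrite mulr1.
Qed.

Lemma sqintegrable_snd g : sqintegrable nu g -> sqintegrable P (fun z => g z.2).
Proof.
move=> Lg; have := sqintegrable_tensor (sqintegrable_cst mu 1) Lg.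
by under eq_fun do rewrite mul1r.
Qed.

Lemma sqintegrable_prod_rintegrable w : sqintegrable P w -> rintegrable P w.
Proof.
move=> Lw; have := sqintegrableM Lw (sqintegrable_fst (sqintegrable_cst mu 1)).
by congr rintegrable; apply/funext => x; rewrite mulr1.
Qed.

(** Cauchy-Schwarz on almost every section bounds the square by an integrable function of [x]. *)
Lemma sqintegrable_Rint1 w : 0 < fine (nu setT) -> sqintegrable P w ->
  sqintegrable mu (fun x => \int[nu]_y w (x, y)).
Proof.
move=> nu0 Lw; have [mw Iw2] := Lw.
have Iw := sqintegrable_prod_rintegrable Lw.
have mI := measurable_rintegrable (rintegrable_Rint1 Iw).
pose B x := fine (nu setT) * \int[nu]_y (w (x, y) ^+ 2).
have IB : rintegrable mu B by apply: rintegrableZ; exact: (rintegrable_Rint1 Iw2).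
(* Capping by [B] makes the bound valid at every [x] and changes the square only on a null set. *)
pose F x := Num.min ((\int[nu]_y w (x, y)) ^+ 2) (B x).
split => //.
apply: (@ae_rintegrable _ _ _ _ F); first exact: measurable_funX.
  apply: filterS (rintegrable_section1 Iw2) => x I2.
  apply/min_idPl; apply: sqr_Rint_le => //; split => //.
  exact: measurable_section1.
apply: (rintegrable_dom _ (rintegrable_norm IB)).
  apply: measurable_minr; first exact: measurable_funX.
  exact: measurable_rintegrable IB.
move=> x; rewrite /F; have [h|h] := leP ((\int[nu]_y w (x, y)) ^+ 2) (B x).
  by rewrite (ger0_norm (sqr_ge0 _)) (le_trans h)// ler_norm.
by [].
Qed.

(** Since [nu] has positive mass, some [y] has an integrable section, from which [f] differs by the
    constant [g y]. *)
Lemma rintegrable_oplus_fst f g : 0 < fine (nu setT) -> measurable_fun setT f ->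
  rintegrable P (fun z => f z.1 - g z.2) -> rintegrable mu f.
Proof.
move=> nu0 mf /rintegrable_section2 /=.
move=> [N [mN N0 H]].
have [y nNy] : exists y, ~ N y.
  apply: contrapT => /forallNP allN; move: nu0.
  rewrite (_ : setT = N) ?N0 ?ltxx//.
  by apply/seteqP; split => // y _; apply: contrapT; exact: allN.
have Iy : rintegrable mu (fun x => f x - g y).
  by apply: contrapT => /H.
have := rintegrableD Iy (rintegrable_cst mu (g y)).
by under eq_fun do rewrite subrK.
Qed.

End product_integrals2.

(** * Fatou's lemma and almost everywhere limits *)

Section ae_limits.
Context d (T : measurableType d) (R : realType).
Variable m : {measure set T -> \bar R}.

Lemma measurable_limn_einf (f : nat -> T -> \bar R) :
  (forall n, measurable_fun setT (f n)) ->
  measurable_fun setT (fun x => limn_einf (f ^~ x)).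
Proof.
move=> mf; apply: measurableT_comp => //.
by apply: measurable_fun_limn_esup => n; exact: measurableT_comp.
Qed.

Lemma le_fatou (f : nat -> T -> \bar R) (C : \bar R) :
  (forall n, measurable_fun setT (f n)) -> (forall n x, (0 <= f n x)%E) ->
  (forall n, (\int[m]_x f n x <= C)%E) ->
  (\int[m]_x limn_einf (f ^~ x) <= C)%E.
Proof.
move=> mf f0 fC; apply: le_trans (fatou m measurableT mf _) _ => //.
rewrite limn_einf_lim; apply: lime_le; first exact: is_cvg_einfs.
apply: nearW => n; apply: le_trans (fC n).
by apply: ereal_inf_lbound; exists n => /=.
Qed.

Lemma Rint_fatou (f : nat -> T -> R) (g : T -> R) (C : R) :
  (forall n, rintegrable m (f n)) -> (forall n x, 0 <= f n x) ->
  measurable_fun setT g -> (forall x, 0 <= g x) ->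
  {ae m, forall x, f n x @[n --> \oo] --> g x} ->
  (forall n, \int[m]_x f n x <= C) ->
  rintegrable m g /\ \int[m]_x g x <= C.
Proof.
move=> If f0 mg g0 fg fC.
have mf n : measurable_fun setT (fun x => (f n x)%:E).
  by apply/measurable_EFinP; exact: measurable_rintegrable (If n).
have gC : (\int[m]_x (g x)%:E <= C%:E)%E.
  have -> : (\int[m]_x (g x)%:E = \int[m]_x limn_einf (fun n => (f n x)%:E))%E.
    apply: ae_eq_integral => //; [exact/measurable_EFinP|exact: measurable_limn_einf|].
    apply: filterS fg => x fgx _; apply/esym.
    by apply: (cvg_limn_einf_sup _).1; apply: cvg_EFin => //; exact: nearW.
  apply: le_fatou => // n.
  by rewrite RintegralE_EFin// lee_fin.
have Ig : rintegrable m g.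
  by apply/ge0_rintegrableP => //; rewrite (le_lt_trans gC)// ltry.
by split => //; rewrite -lee_fin -RintegralE_EFin.
Qed.

(** Only convergence in the extended reals is assumed. By Fatou the limit inferior of the absolute
    values is integrable, hence finite a.e., and so is the limit itself. *)
Lemma L1_bounded_cvg (u : nat -> T -> R) (C : R) :
  (forall n, rintegrable m (u n)) ->
  (forall n, \int[m]_x `|u n x| <= C) ->
  {ae m, forall x, cvgn (fun n => (u n x)%:E)} ->
  exists2 v : T -> R, measurable_fun setT v &
    {ae m, forall x, u n x @[n --> \oo] --> v x}.
Proof.
move=> Iu uC ucvg.
have mu n : measurable_fun setT (fun x => (u n x)%:E).
  by apply/measurable_EFinP; exact: measurable_rintegrable (Iu n).
pose a n x := `|(u n x)%:E|%E.
have ma n : measurable_fun setT (a n) by exact: measurableT_comp.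
have lC : (\int[m]_x limn_einf (a ^~ x) <= C%:E)%E.
  apply: le_fatou => // [n x|n]; first exact: abse_ge0.
  by have := uC n; rewrite -lee_fin -(RintegralE_EFin (rintegrable_norm (Iu n))).
have a0 x : (0 <= limn_einf (a ^~ x))%E.
  rewrite limn_einf_lim; apply: lime_ge; first exact: is_cvg_einfs.
  by apply: nearW => n; apply: le_ereal_inf_tmp => _ [k _ <-]; exact: abse_ge0.
have fin : {ae m, forall x, limn_einf (a ^~ x) \is a fin_num}.
  have /integrable_ae : m.-integrable setT (fun x => limn_einf (a ^~ x)).
    apply/integrableP; split; first exact: measurable_limn_einf.
    by under eq_integral do rewrite gee0_abs//; rewrite (le_lt_trans lC)// ltry.
  by move=> /(_ measurableT); apply: filterS => x /(_ I).
exists (fun x => fine (limn_esup (fun n => (u n x)%:E))).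
  apply: (measurableT_comp (fine_measurable measurableT)).
  exact: measurable_fun_limn_esup.
apply: filterS2 ucvg fin => x ux.
rewrite (is_cvg_limn_esupE ux); set S := limn _.
have -> : limn_einf (a ^~ x) = `|S|%E.
  by apply: (cvg_limn_einf_sup _).1; exact: cvg_abse.
rewrite abse_fin_num => Sfin.
have : (u n x)%:E @[n --> \oo] --> (fine S)%:E by rewrite fineK.
by move/fine_cvgP => [].
Qed.

End ae_limits.

(** * Null sets of products and sectionwise comparison of integrals *)

Section product_ae.
Context d1 d2 (X : measurableType d1) (Y : measurableType d2) (R : realType).
Variables (mu : {finite_measure set X -> \bar R})
  (nu : {finite_measure set Y -> \bar R}).
Local Notation P := (mu \x nu)%E.

Lemma ae_fst (Q : X -> Prop) : {ae mu, forall x, Q x} ->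
  {ae P, forall z, Q z.1}.
Proof.
move=> [N [mN N0 QN]]; exists (N `*` setT); split.
- exact: measurableX.
- transitivity (mu N * nu setT)%E; first exact: product_measure1E.
  by rewrite N0 mul0e.
- by move=> z nQ; split => //; exact: QN.
Qed.

Lemma ae_snd (Q : Y -> Prop) : {ae nu, forall y, Q y} ->
  {ae P, forall z, Q z.2}.
Proof.
move=> [N [mN N0 QN]]; exists (setT `*` N); split.
- exact: measurableX.
- transitivity (mu setT * nu N)%E; first exact: product_measure1E.
  by rewrite N0 mule0.
- by move=> z nQ; split => //; exact: QN.
Qed.

(** By Tonelli, the comparison on sections first gives the integrability of [w']; the inequality
    then follows from Fubini. *)
Lemma le_Rint_sections (w w' : X * Y -> R) :
  rintegrable P w -> (forall z, 0 <= w z) ->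
  measurable_fun setT w' -> (forall z, 0 <= w' z) ->
  {ae mu, forall x, rintegrable nu (fun y => w' (x, y)) /\
     \int[nu]_y w' (x, y) <= \int[nu]_y w (x, y)} ->
  rintegrable P w' /\ \int[P]_z w' z <= \int[P]_z w z.
Proof.
move=> Iw w0 mw' w'0 H.
have mw := measurable_rintegrable Iw.
have Ew : {ae mu, forall x, (\int[nu]_y `|(w' (x, y))%:E| <= \int[nu]_y `|(w (x, y))%:E|)%E}.
  apply: filterS2 H (rintegrable_section1 Iw) => x [I' le'] I.
  under eq_integral do rewrite gee0_abs ?lee_fin//.
  under [leRHS]eq_integral do rewrite gee0_abs ?lee_fin//.
  by rewrite (RintegralE_EFin I') (RintegralE_EFin I) lee_fin.
have mF v : measurable_fun [set: X * Y] v ->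
    measurable_fun setT (fun x => \int[nu]_y `|(v (x, y) : R)%:E|)%E.
  move=> mv; apply: (measurable_fun_fubini_tonelli_F (fun z => `|(v z)%:E|%E)) => //.
  by apply: measurableT_comp => //; exact/measurable_EFinP.
have Iw' : rintegrable P w'.
  apply/integrable12ltyP; first exact/measurable_EFinP.
  have := (integrable12ltyP mu nu (measurable_int _ Iw)).1 Iw.
  apply: le_lt_trans; apply: ae_ge0_le_integral => //.
  - by move=> x _; apply: integral_ge0.
  - exact: mF.
  - by move=> x _; apply: integral_ge0.
  - exact: mF.
  - by apply: filterS Ew => x.
split => //; rewrite !Rint_fubini1//; apply: ae_le_Rint.
- exact: rintegrable_Rint1.
- exact: rintegrable_Rint1.
- by apply: filterS H => x [].
Qed.

End product_ae.

(** * The dual problem *)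

Section running_max.
Context {T : Type} {R : realType}.
Implicit Types u : nat -> T -> R.

(** The supremum over [k] followed by the infimum over [N] is the limit superior of [u]. The maximum
    is built one term at a time because submodularity treats two pairs at a time. *)
Fixpoint running_max u (N k : nat) : T -> R :=
  if k is k'.+1 then fun x => Num.max (running_max u N k' x) (u (N + k'.+1)%N x)
  else u N.

Lemma running_max_ge u N k x : u N x <= running_max u N k x.
Proof. by elim: k => //= k IH; rewrite le_max IH. Qed.

Lemma running_max_le u N k x t : (forall n, u n x <= t) -> running_max u N k x <= t.
Proof. by move=> ut; elim: k => //= k IH; rewrite ge_max IH ut. Qed.

Lemma running_max_is_cvg u N x : cvgn (fun k => (running_max u N k x)%:E).
Proof.
apply: ereal_nondecreasing_is_cvgn; apply/nondecreasing_seqP => k.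
by rewrite lee_fin /= le_max lexx.
Qed.

(** The indices from [N.+1] to [N.+1 + k] are among those from [N] to [N + k.+1]. *)
Lemma running_maxS u N k x : running_max u N.+1 k x <= running_max u N k.+1 x.
Proof.
elim: k => [|k IH]; first by rewrite /= addn1 le_max lexx orbT.
rewrite [leLHS]/= (_ : running_max u N k.+2 x =
  Num.max (running_max u N k.+1 x) (u (N + k.+2)%N x))//.
rewrite addSnnS ge_max; apply/andP; split; last by rewrite le_max lexx orbT.
by apply: le_trans IH _; rewrite le_max lexx.
Qed.

(** The limits in [k] are suprema over the tails starting at [n], hence nonincreasing in [n]. *)
Lemma running_max_lim_is_cvg u (v : nat -> T -> R) x :
  (forall n, running_max u n k x @[k --> \oo] --> v n x) ->
  cvgn (fun n => (v n x)%:E).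
Proof.
move=> uv; apply: ereal_nonincreasing_is_cvgn; apply/nonincreasing_seqP => n.
(* Shifted by one, since [running_maxS] compares [k] steps after [n.+1] with [k.+1] steps after
   [n]. *)
have uvS : running_max u n k.+1 x @[k --> \oo] --> v n x.
  by have := uv n; rewrite -(cvg_shiftn 1); under eq_fun do rewrite addn1.
rewrite lee_fin; apply: (ler_cvg_to (uv n.+1) uvS).
by apply: nearW => k; exact: running_maxS.
Qed.

End running_max.

(** * Existence of a dual minimizer *)

Section dual_problem.
Context d1 d2 (X : measurableType d1) (Y : measurableType d2) (R : realType).
Variables (mu : {finite_measure set X -> \bar R})
  (nu : {finite_measure set Y -> \bar R}).
Local Notation P := (mu \x nu)%E.
Variables (gamma delta : R) (c : X * Y -> R) (f1 : X -> R) (f2 : Y -> R).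
Hypotheses (gamma_gt0 : 0 < gamma) (delta_gt0 : 0 < delta).
Hypotheses (Lc : sqintegrable P c) (Lf1 : sqintegrable mu f1)
  (Lf2 : sqintegrable nu f2).
Hypotheses (f1_ge : forall x, delta <= f1 x) (f2_ge : forall y, delta <= f2 y).
Hypotheses (f1_int : \int[mu]_x f1 x = 1) (f2_int : \int[nu]_y f2 y = 1).
Implicit Types (a : X -> R) (b : Y -> R).

Local Notation M1 := (fine (mu setT)).
Local Notation M2 := (fine (nu setT)).

Let mc : measurable_fun setT c := Lc.1.
Let mf1 : measurable_fun setT f1 := Lf1.1.
Let mf2 : measurable_fun setT f2 := Lf2.1.
Let M1_gt0 : 0 < M1 := finite_mass_gt0 mf1 f1_int.
Let M2_gt0 : 0 < M2 := finite_mass_gt0 mf2 f2_int.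

(* [f1 (x) f2] is a feasible plan: subtracting its pairing with the potentials
   turns the dual functional into the integral of a nonnegative function. *)
Definition ref_plan (z : X * Y) : R := gamma * (f1 z.1 * f2 z.2).

Definition slack a b (z : X * Y) : R := a z.1 - b z.2 - c z.

(** When all terms are integrable, its integral is half the squared L^2 norm of the positive part of
    the slack, minus [gamma] times the difference of the integrals of [f1 * a] and [f2 * b], plus a
    constant independent of the potentials. *)
Definition dual_density a b (z : X * Y) : R :=
  dual_integrand (ref_plan z) (slack a b z).

(** Only a finite dual value is asked of the potentials; square integrability is recovered later
    from the marginal equations. *)
Definition dual_admissible a b :=
  [/\ measurable_fun setT a, measurable_fun setT b & rintegrable P (dual_density a b)].

Definition dual_value a b : R := \int[P]_z dual_density a b z.

Let e0 := gamma * (delta * delta).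
Let e0_gt0 : 0 < e0. Proof. by rewrite !mulr_gt0. Qed.

Lemma ref_plan_ge z : e0 <= ref_plan z.
Proof. by rewrite ler_pM2l// ler_pM// ltW. Qed.

Lemma ref_plan_ge0 z : 0 <= ref_plan z.
Proof. exact: le_trans (ltW e0_gt0) (ref_plan_ge z). Qed.

Lemma sqintegrable_ref_plan : sqintegrable P ref_plan.
Proof. by apply: sqintegrableZ; exact: sqintegrable_tensor. Qed.

Let mk : measurable_fun setT ref_plan := sqintegrable_ref_plan.1.

Lemma measurable_slack a b : measurable_fun setT a -> measurable_fun setT b ->
  measurable_fun setT (slack a b).
Proof.
by move=> ma mb; apply: measurable_funB => //; apply: measurable_funB;
  exact: measurableT_comp.
Qed.

Lemma measurable_dual_density a b : measurable_fun setT a -> measurable_fun setT b ->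
  measurable_fun setT (dual_density a b).
Proof.
move=> ma mb; have ms := measurable_slack ma mb.
apply: measurable_funD; last first.
  apply: measurable_funM => //; apply: measurable_maxr => //.
  exact: measurableT_comp.
apply: measurable_funM => //; apply: measurable_funX; apply: measurable_funB => //.
exact: measurable_maxr.
Qed.

Lemma dual_density_ge0 a b z : 0 <= dual_density a b z.
Proof. by apply: dual_integrand_ge0; exact: ref_plan_ge0. Qed.

Lemma dual_value_ge0 a b : 0 <= dual_value a b.
Proof. by apply: Rintegral_ge0 => z _; exact: dual_density_ge0. Qed.

Lemma dual_admissible0 : dual_admissible (fun=> 0) (fun=> 0).
Proof.
split => //; set h := dual_density _ _.
have -> : h = fun z => (2^-1 * pos_part (- c z) ^+ 2 - ref_plan z * - c z) +
    2^-1 * ref_plan z ^+ 2.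
  apply/funext => z; rewrite /h /dual_density dual_integrandE /slack !sub0r oppr0 add0r.
  by rewrite mulrC [_ / 2]mulrC.
apply: rintegrableD; last by apply: rintegrableZ; exact: sqintegrable_ref_plan.2.
apply: rintegrableB.
  by apply: rintegrableZ; exact: (sqintegrable_pos_part (sqintegrableN Lc)).2.
exact: (sqintegrableM sqintegrable_ref_plan (sqintegrableN Lc)).
Qed.

(** Constants of the coercivity estimate: [K0] multiplies the density, and [rest] collects the
    integrable terms free of the potentials. *)
Let K0 := 4 + e0^-1.
Let rest z := (1 + 2 * ref_plan z ^+ 2) + `|c z|.
Let H0 := \int[P]_z rest z.

Let Irest : rintegrable P rest.
Proof.
apply: rintegrableD.
  apply: rintegrableD; first exact: rintegrable_prod_cst.
  by apply: rintegrableZ; exact: sqintegrable_ref_plan.2.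
by apply: rintegrable_norm; exact: sqintegrable_prod_rintegrable.
Qed.

Let density_coercive a b z :
  `|a z.1 - b z.2| <= K0 * dual_density a b z + rest z.
Proof.
have := dual_integrand_coercive (slack a b z) e0_gt0 (ref_plan_ge z).
rewrite -/K0 -/(dual_density a b z) /rest => h.
have -> : a z.1 - b z.2 = slack a b z + c z by rewrite /slack subrK.
by rewrite (le_trans (ler_normD _ _))// addrA lerD2r.
Qed.

Let K0_ge0 : 0 <= K0.
Proof. by rewrite addr_ge0// invr_ge0 ltW. Qed.

Let I_diff a b : dual_admissible a b -> rintegrable P (fun z => a z.1 - b z.2).
Proof.
move=> [ma mb Iab].
apply: (rintegrable_dom _ (rintegrableD (rintegrableZ K0 Iab) Irest)).
  by apply: measurable_funB; exact: measurableT_comp.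
by move=> z; exact: density_coercive.
Qed.

Let diff_bound a b : dual_admissible a b ->
  \int[P]_z `|a z.1 - b z.2| <= K0 * dual_value a b + H0.
Proof.
move=> Aab; have [ma mb Iab] := Aab.
rewrite -Rint_Z// -Rint_D//; last exact: rintegrableZ.
apply: le_Rint; first exact: rintegrable_norm (I_diff Aab).
  by apply: rintegrableD => //; exact: rintegrableZ.
by move=> z; exact: density_coercive.
Qed.

Lemma admissible_rintegrable1 a b : dual_admissible a b -> rintegrable mu a.
Proof.
by move=> Aab; have [ma mb _] := Aab; exact: rintegrable_oplus_fst (I_diff Aab).
Qed.

Lemma admissible_rintegrable2 a b : dual_admissible a b -> rintegrable nu b.
Proof.
move=> Aab; have [ma mb _] := Aab.
apply: (@rintegrable_oplus_fst _ _ _ _ _ nu mu b a) => //.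
have := rintegrableN (rintegrable_swap (I_diff Aab)).
by congr rintegrable; apply/funext => z; rewrite opprB.
Qed.

Lemma Rint_diff a b : rintegrable mu a -> rintegrable nu b ->
  \int[P]_z (a z.1 - b z.2) = M2 * \int[mu]_x a x - M1 * \int[nu]_y b y.
Proof.
move=> Ia Ib; rewrite Rint_B; [|exact: rintegrable_fst|exact: rintegrable_snd].
by rewrite Rint_fst// Rint_snd// mulrC [X in _ - X]mulrC.
Qed.

(** Reverse triangle inequality: [|b y| - |a x|] is at most [|a x - b y|], whose integral the dual
    value controls. *)
Let b_bound a b : dual_admissible a b ->
  M1 * \int[nu]_y `|b y| <= K0 * dual_value a b + H0 + M2 * \int[mu]_x `|a x|.
Proof.
move=> Aab.
have Ia := admissible_rintegrable1 Aab; have Ib := admissible_rintegrable2 Aab.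
rewrite -lerBlDr; apply: le_trans (diff_bound Aab).
rewrite -lerN2 opprB -(Rint_diff (rintegrable_norm Ia) (rintegrable_norm Ib)).
rewrite -Rint_N; last exact: rintegrable_norm (I_diff Aab).
apply: le_Rint.
- exact: rintegrableN (rintegrable_norm (I_diff Aab)).
- apply: rintegrableB.
  + exact: rintegrable_fst (rintegrable_norm Ia).
  + exact: rintegrable_snd (rintegrable_norm Ib).
- by move=> z; rewrite lerNl opprB distrC lerB_dist.
Qed.

(** With [b] of mean zero, the right-hand side is the integral of [a x - b y]. *)
Let a_bound a b : dual_admissible a b -> \int[nu]_y b y = 0 ->
  - (K0 * dual_value a b + H0) <= M2 * \int[mu]_x a x.
Proof.
move=> Aab b0.
have Ia := admissible_rintegrable1 Aab; have Ib := admissible_rintegrable2 Aab.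
have := Rint_diff Ia Ib; rewrite b0 mulr0 subr0 => <-.
rewrite lerNl; apply: le_trans (diff_bound Aab).
rewrite -Rint_N; last exact: I_diff.
apply: le_Rint; [exact: rintegrableN (I_diff Aab)|exact: rintegrable_norm (I_diff Aab)|].
by move=> z; rewrite -normrN ler_norm.
Qed.

(** Integrates [dual_integrand_submodular]. The densities being nonnegative, each new one is
    dominated by the sum of the two old ones, which gives admissibility. *)
Lemma dual_submodular a b a' b' : dual_admissible a b -> dual_admissible a' b' ->
  let a2 x := Num.max (a x) (a' x) in let b2 y := Num.max (b y) (b' y) in
  let a3 x := Num.min (a x) (a' x) in let b3 y := Num.min (b y) (b' y) in
  [/\ dual_admissible a2 b2, dual_admissible a3 b3 &
      dual_value a2 b2 + dual_value a3 b3 <= dual_value a b + dual_value a' b'].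
Proof.
move=> [ma mb I1] [ma' mb' I2] a2 b2 a3 b3.
have ma2 : measurable_fun setT a2 by exact: measurable_maxr.
have mb2 : measurable_fun setT b2 by exact: measurable_maxr.
have ma3 : measurable_fun setT a3 by exact: measurable_minr.
have mb3 : measurable_fun setT b3 by exact: measurable_minr.
have sub z : dual_density a2 b2 z + dual_density a3 b3 z <=
    dual_density a b z + dual_density a' b' z.
  exact: dual_integrand_submodular.
have I12 := rintegrableD I1 I2.
have I3 : rintegrable P (dual_density a2 b2).
  apply: (rintegrable_dom (measurable_dual_density ma2 mb2) I12) => z.
  rewrite ger0_norm ?dual_density_ge0//; apply: le_trans (sub z).
  by rewrite lerDl dual_density_ge0.
have I4 : rintegrable P (dual_density a3 b3).
  apply: (rintegrable_dom (measurable_dual_density ma3 mb3) I12) => z.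
  rewrite ger0_norm ?dual_density_ge0//; apply: le_trans (sub z).
  by rewrite lerDr dual_density_ge0.
split; [by split|by split|].
rewrite /dual_value -!Rint_D//.
by apply: le_Rint => //; exact: rintegrableD.
Qed.

(** The slack depends on the potentials only through [a x - b y]. The shift serves to give [b] mean
    zero. *)
Lemma dual_shift a b t : dual_admissible a b ->
  let a' x := a x + t in let b' y := b y + t in
  dual_admissible a' b' /\ dual_value a' b' = dual_value a b.
Proof.
move=> [ma mb Iab] a' b'.
have E : dual_density a' b' = dual_density a b.
  apply/funext => z; congr dual_integrand; rewrite /slack /a' /b'; lra.
by rewrite /dual_value E; split => //; split; rewrite ?E//; exact: measurable_funD.
Qed.

(** Lower semicontinuity along a.e. convergent potentials, by Fatou's lemma for the nonnegative
    densities. *)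
Lemma dual_closed (a_ : nat -> X -> R) (b_ : nat -> Y -> R) a b C :
  (forall n, dual_admissible (a_ n) (b_ n)) ->
  (forall n, dual_value (a_ n) (b_ n) <= C) ->
  measurable_fun setT a -> measurable_fun setT b ->
  {ae mu, forall x, a_ n x @[n --> \oo] --> a x} ->
  {ae nu, forall y, b_ n y @[n --> \oo] --> b y} ->
  dual_admissible a b /\ dual_value a b <= C.
Proof.
move=> Aab abC ma mb aa bb.
suff [Iab le_C] : rintegrable P (dual_density a b) /\ dual_value a b <= C by split.
apply: (@Rint_fatou _ _ _ _ (fun n => dual_density (a_ n) (b_ n))) => //.
- by move=> n; have [] := Aab n.
- by move=> n z; exact: dual_density_ge0.
- exact: measurable_dual_density.
- by move=> z; exact: dual_density_ge0.
- apply: filterS2 (ae_fst nu aa) (ae_snd mu bb) => z az bz.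
  apply: cvg_dual_integrand; apply: cvgB; last exact: cvg_cst.
  exact: cvgB.
Qed.

(** The number [t] for which [t - b y - c (x, y)] integrates over [y] to [gamma * f1 x], whenever
    [b] has mean zero. *)
Definition potential_ub x : R := M2^-1 * (gamma * f1 x + \int[nu]_y c (x, y)).

Lemma sqintegrable_potential_ub : sqintegrable mu potential_ub.
Proof.
apply: sqintegrableZ; apply: sqintegrableD; first exact: sqintegrableZ.
exact: sqintegrable_Rint1.
Qed.

(* One-dimensional convexity in the value [a x]: at the level [potential_ub x]
   the marginal already exceeds [gamma * f1 x], so larger values do not help. *)
Lemma dual_truncate a b : dual_admissible a b -> \int[nu]_y b y = 0 ->
  let a' x := Num.min (a x) (potential_ub x) in
  dual_admissible a' b /\ dual_value a' b <= dual_value a b.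
Proof.
move=> Aab b0 a'; have [ma mb Iab] := Aab.
have Ib := admissible_rintegrable2 Aab.
have ma' : measurable_fun setT a'.
  by apply: measurable_minr => //; exact: sqintegrable_potential_ub.1.
have md := measurable_dual_density ma' mb.
suff : {ae mu, forall x, rintegrable nu (fun y => dual_density a' b (x, y)) /\
     \int[nu]_y dual_density a' b (x, y) <= \int[nu]_y dual_density a b (x, y)}.
  move=> H; have [I' le'] := le_Rint_sections Iab (dual_density_ge0 a b) md
    (dual_density_ge0 a' b) H.
  by split.
have Ic := sqintegrable_prod_rintegrable Lc.
apply: filterS2 (rintegrable_section1 Iab) (rintegrable_section1 Ic) => x Iabx Icx.
have [aU|Ua] := leP (a x) (potential_ub x).
  have E : (fun y => dual_density a' b (x, y)) = (fun y => dual_density a b (x, y)).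
    by apply/funext => y; congr dual_integrand; rewrite /slack /= /a' (min_idPl aU).
  by rewrite E.
have a'E : a' x = potential_ub x by rewrite /a' (min_idPr (ltW Ua)).
pose h := a x - potential_ub x; have h_gt0 : 0 < h by rewrite subr_gt0.
pose s' y := potential_ub x - b y - c (x, y).
have Is' : rintegrable nu s'.
  apply: rintegrableB => //; apply: rintegrableB => //; exact: rintegrable_cst.
have Is'p : rintegrable nu (fun y => pos_part (s' y)).
  apply: (rintegrable_dom _ (rintegrable_norm Is')).
    by apply: measurable_maxr => //; exact: measurable_rintegrable Is'.
  by move=> y; rewrite ger0_norm ?pos_part_ge0// pos_part_norm.
have kE : (fun y => ref_plan (x, y)) = fun y => gamma * f1 x * f2 y.
  by apply/funext => y; rewrite /ref_plan mulrA.
have If2 := sqintegrable_rintegrable Lf2.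
have Ik : rintegrable nu (fun y => ref_plan (x, y)) by rewrite kE; exact: rintegrableZ.
have kint : \int[nu]_y ref_plan (x, y) = gamma * f1 x.
  by rewrite kE Rint_Z// f2_int mulr1.
have s'int : \int[nu]_y ref_plan (x, y) <= \int[nu]_y pos_part (s' y).
  have -> : \int[nu]_y ref_plan (x, y) = \int[nu]_y s' y.
    rewrite kint Rint_B//; last by apply: rintegrableB => //; exact: rintegrable_cst.
    rewrite Rint_B//; last exact: rintegrable_cst.
    rewrite Rint_cst b0 subr0 /potential_ub mulrAC mulVf ?gt_eqF// mul1r.
    by rewrite addrK.
  by apply: le_Rint => // y; exact: pos_part_ge.
(* Tangent inequality from the truncated slack [s'] to the original one; by [s'int] the first-order
   term has nonnegative integral. *)
have key y : dual_density a' b (x, y) + h * (pos_part (s' y) - ref_plan (x, y)) <=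
    dual_density a b (x, y).
  have := dual_integrand_ge (ref_plan (x, y)) (s' y) h.
  rewrite mulrC; congr (_ <= _); last first.
    by congr dual_integrand; rewrite /s' /h /slack /=; lra.
  by congr (dual_integrand _ _ + _); rewrite /slack /= a'E.
have Ih : rintegrable nu (fun y => h * (pos_part (s' y) - ref_plan (x, y))).
  by apply: rintegrableZ; exact: rintegrableB.
have I' : rintegrable nu (fun y => dual_density a' b (x, y)).
  apply: (rintegrable_dom _ (rintegrableB Iabx Ih)).
    exact: measurable_section1.
  by move=> y; rewrite ger0_norm ?dual_density_ge0// lerBrDr.
split => //.
have : \int[nu]_y (dual_density a' b (x, y) + h * (pos_part (s' y) - ref_plan (x, y)))
    <= \int[nu]_y dual_density a b (x, y).
  by apply: le_Rint => //; exact: rintegrableD.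
rewrite Rint_D// Rint_Z; last exact: rintegrableB.
rewrite Rint_B//; apply: le_trans.
by rewrite lerDl; apply: mulr_ge0; [exact: ltW|rewrite subr_ge0].
Qed.

(* The limit superior of a fast minimizing sequence is a minimizer: by
   submodularity the running maxima [max (u N, ..., u (N + k))] exceed the
   infimum by at most the sum of the individual defects. *)
Lemma dual_minimizer : exists a b, dual_admissible a b /\
  forall a' b', dual_admissible a' b' -> dual_value a b <= dual_value a' b'.
Proof.
pose S := [set r | exists a b, dual_admissible a b /\ r = dual_value a b].
have lbS : has_lbound S by exists 0 => _ [a [b [_ ->]]]; exact: dual_value_ge0.
have infS : has_inf S.
  split => //; exists (dual_value (fun=> 0) (fun=> 0)); do 2 eexists.
  by split; first exact: dual_admissible0.
pose m := inf S.
have mS a b : dual_admissible a b -> m <= dual_value a b.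
  by move=> Aab; apply: ge_inf => //; exists a, b.
(* Geometric errors: those from index [N] on sum to [2 * e N]. *)
pose e n : R := 2^-1 ^+ n.
have e_gt0 n : 0 < e n by rewrite exprn_gt0// invr_gt0.
have eS n : e n = 2 * e n.+1 by rewrite /e exprS mulrA divff// mul1r.
have e_le1 n : e n <= 1 by rewrite exprn_ile1// invf_le1// ler1n.
pose U := potential_ub.
have IU : rintegrable mu U := sqintegrable_rintegrable sqintegrable_potential_ub.
(* Each almost minimizer is normalized: a shift gives [b] mean zero, then [a] is cut off at [U].
   Neither operation raises the dual value. *)
have ex n : exists p : (X -> R) * (Y -> R), [/\ dual_admissible p.1 p.2,
    \int[nu]_y p.2 y = 0, forall x, p.1 x <= U x & dual_value p.1 p.2 <= m + e n].
  have [_ [a [b [Aab ->]]] lt_e] := inf_adherent (e_gt0 n) infS.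
  have Ib := admissible_rintegrable2 Aab.
  pose t := - (M2^-1 * \int[nu]_y b y).
  have [Aab' abE] := dual_shift t Aab.
  have b'0 : \int[nu]_y (b y + t) = 0.
    rewrite Rint_D//; last exact: rintegrable_cst.
    by rewrite Rint_cst /t mulNr mulrAC mulVf ?gt_eqF// mul1r subrr.
  have [Aab'' le''] := dual_truncate Aab' b'0.
  exists (fun x => Num.min (a x + t) (U x), fun y => b y + t); split => //=.
    by move=> x; rewrite ge_min lexx orbT.
  by rewrite (le_trans le'')// abE ltW.
have [p Hp] := choice ex.
pose A n := (p n).1; pose B n := (p n).2.
have AB n : dual_admissible (A n) (B n) by have [] := Hp n.
have B0 n : \int[nu]_y B n y = 0 by have [] := Hp n.
have AU n x : A n x <= U x by have [_ _ + _] := Hp n; exact.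
have ABm n : dual_value (A n) (B n) <= m + e n by have [] := Hp n.
(* [2 * e N - e (N + k)] is the sum of the errors [e N, ..., e (N + k)]. *)
have maxP N k : dual_admissible (running_max A N k) (running_max B N k) /\
    dual_value (running_max A N k) (running_max B N k) <= m + 2 * e N - e (N + k)%N.
  elim: k => [|k [IH1 IH2]]; first by split => //=; rewrite addn0; have := ABm N; lra.
  have [H1 H2 H3] := dual_submodular IH1 (AB (N + k.+1)%N).
  split => //; have h4 := mS _ _ H2; have h5 := ABm (N + k.+1)%N.
  have := eS (N + k)%N; rewrite -addnS => h6.
  set V := dual_value _ _.
  (* The pair of minima has value at least [m], so the defect of the pair of maxima is at most the
     sum of the two old defects. *)
  have h7 : V + m <= m + 2 * e N - e (N + k)%N + (m + e (N + k.+1)%N).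
    by apply: le_trans (lerD (lexx V) h4) _; apply: le_trans H3 _; exact: lerD.
  by move: h6 h7; lra.
have maxA N k := (maxP N k).1.
have maxV N k : dual_value (running_max A N k) (running_max B N k) <= m + 2 * e N.
  by have := (maxP N k).2; have := e_gt0 (N + k)%N; lra.
(* All values met below are at most [m + 2], because every [e n] is at most 1. *)
pose C0 := K0 * (m + 2) + H0.
have bnd (V : R) C : V <= m + 2 * e C -> K0 * V + H0 <= C0.
  by move=> V2; rewrite lerD2r ler_wpM2l//; have := e_le1 C; lra.
(* Limit in [k] for fixed [N]. The maxima of [A] stay between [A N] and [U], and [b_bound] controls
   those of [B], so the L^1 bounds are uniform in [k]. *)
have ex2 N : exists q : (X -> R) * (Y -> R),
    [/\ dual_admissible q.1 q.2, dual_value q.1 q.2 <= m + 2 * e N,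
    {ae mu, forall x, running_max A N k x @[k --> \oo] --> q.1 x} &
    {ae nu, forall y, running_max B N k y @[k --> \oo] --> q.2 y}].
  pose CA := \int[mu]_x (`|U x| + `|A N x|).
  have IA k : rintegrable mu (running_max A N k) := admissible_rintegrable1 (maxA N k).
  have IB k : rintegrable nu (running_max B N k) := admissible_rintegrable2 (maxA N k).
  have bA k : \int[mu]_x `|running_max A N k x| <= CA.
    apply: le_Rint; first exact: rintegrable_norm (IA k).
      apply: rintegrableD; first exact: rintegrable_norm.
      exact: rintegrable_norm (IA 0%N).
    move=> x; rewrite ler_norml.
    have := running_max_ge A N k x; have := @running_max_le _ _ A N k x (U x) (AU^~ x).
    have := ler_norm (U x); have := ler_norm (- A N x); rewrite normrN.
    by have := normr_ge0 (U x); have := normr_ge0 (A N x); lra.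
  have bB k : \int[nu]_y `|running_max B N k y| <= M1^-1 * (C0 + M2 * CA).
    rewrite ler_pdivlMl//; apply: le_trans (b_bound (maxA N k)) _.
    by apply: lerD; [exact: bnd|rewrite ler_pM2l].
  have cA : {ae mu, forall x, cvgn (fun k => (running_max A N k x)%:E)}.
    by apply: aeW => x; exact: running_max_is_cvg.
  have cB : {ae nu, forall y, cvgn (fun k => (running_max B N k y)%:E)}.
    by apply: aeW => y; exact: running_max_is_cvg.
  have [qa mqa qaP] := L1_bounded_cvg IA bA cA.
  have [qb mqb qbP] := L1_bounded_cvg IB bB cB.
  have [qA qV] := dual_closed (maxA N) (maxV N) mqa mqb qaP qbP.
  by exists (qa, qb).
have [q Hq] := choice ex2.
pose A2 n := (q n).1; pose B2 n := (q n).2.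
have AB2 n : dual_admissible (A2 n) (B2 n) by have [] := Hq n.
have V2 n : dual_value (A2 n) (B2 n) <= m + 2 * e n by have [] := Hq n.
have cA2 : {ae mu, forall x, forall n, running_max A n k x @[k --> \oo] --> A2 n x}.
  by apply: ae_foralln => n; have [] := Hq n.
have cB2 : {ae nu, forall y, forall n, running_max B n k y @[k --> \oo] --> B2 n y}.
  by apply: ae_foralln => n; have [] := Hq n.
have IA2 n : rintegrable mu (A2 n) := admissible_rintegrable1 (AB2 n).
have IB2 n : rintegrable nu (B2 n) := admissible_rintegrable2 (AB2 n).
(* This bound must not depend on [n]: [A n <= A2 n <= U] a.e., and [a_bound] bounds the integral of
   [A n] from below since [B n] has mean zero. *)
pose CA := \int[mu]_x `|U x| + (\int[mu]_x U x + M2^-1 * C0).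
have bA2 n : \int[mu]_x `|A2 n x| <= CA.
  have IUA : rintegrable mu (fun x => U x - A n x).
    by apply: rintegrableB => //; exact: admissible_rintegrable1 (AB n).
  apply: (@le_trans _ _ (\int[mu]_x (`|U x| + (U x - A n x)))).
    apply: ae_le_Rint; first exact: rintegrable_norm (IA2 n).
      by apply: rintegrableD => //; exact: rintegrable_norm.
    apply: filterS cA2 => x /(_ n) cx.
    have A2U : A2 n x <= U x.
      apply: (ler_cvg_to cx (cvg_cst (U x))).
      by apply: nearW => k; apply: running_max_le.
    have AA2 : A n x <= A2 n x.
      apply: (ler_cvg_to (cvg_cst (A n x)) cx).
      by apply: nearW => k; exact: running_max_ge.
    rewrite ler_norml; have := ler_norm (U x); have := ler_norm (- U x).
    by rewrite normrN; lra.
  rewrite Rint_D//; last exact: rintegrable_norm.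
  rewrite lerD2l Rint_B//; last exact: admissible_rintegrable1 (AB n).
  rewrite lerD2l lerNl -mulrN ler_pdivrMl//.
  apply: le_trans (a_bound (AB n) (B0 n)); rewrite lerN2; apply: (bnd _ n).
  by have := ABm n; have := e_gt0 n; lra.
have bB2 n : \int[nu]_y `|B2 n y| <= M1^-1 * (C0 + M2 * CA).
  rewrite ler_pdivlMl//; apply: le_trans (b_bound (AB2 n)) _.
  by apply: lerD; [exact: (bnd _ n)|rewrite ler_pM2l].
have [a ma aP] : exists2 a : X -> R, measurable_fun setT a &
    {ae mu, forall x, A2 n x @[n --> \oo] --> a x}.
  apply: (L1_bounded_cvg IA2 bA2); apply: filterS cA2 => x.
  exact: running_max_lim_is_cvg.
have [b mb bP] : exists2 b : Y -> R, measurable_fun setT b &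
    {ae nu, forall y, B2 n y @[n --> \oo] --> b y}.
  apply: (L1_bounded_cvg IB2 bB2); apply: filterS cB2 => y.
  exact: running_max_lim_is_cvg.
(* Dropping the first [N] terms keeps the limit and improves the bound on the values. *)
have H N : dual_admissible a b /\ dual_value a b <= m + 2 * e N.
  apply: (@dual_closed (fun n => A2 (n + N)%N) (fun n => B2 (n + N)%N)) => //.
  - move=> n; apply: le_trans (V2 _) _; rewrite lerD2l ler_pM2l//.
    by rewrite /e exprD ler_piMl// ltW.
  - by apply: filterS aP => x; rewrite -(cvg_shiftn N).
  - by apply: filterS bP => y; rewrite -(cvg_shiftn N).
exists a, b; split; first exact: (H 0%N).1.
move=> a' b' /mS; apply: le_trans.
rewrite leNgt; apply/negP => lt_m.
have r0 : 0 < dual_value a b - m by rewrite subr_gt0.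
have : 2 * e n @[n --> \oo] --> (2 * 0 : R).
  by apply: cvgM; [exact: cvg_cst|apply: cvg_expr; rewrite ger0_norm// invf_lt1// ltr1n].
rewrite mulr0 => /cvgr_lt /(_ _ r0) [N _ /(_ N (leqnn N))] /= eN.
by have := (H N).2; lra.
Qed.

End dual_problem.

(** * First-order conditions at a dual minimizer *)

Lemma quadratic_ge0_eq0 (R : realType) (I J : R) :
  (forall t, 0 <= t * I + t ^+ 2 * J) -> I = 0.
Proof.
move=> H; apply/eqP; apply/negPn/negP => I0.
have J0 : 0 < `|J| + 1 by have := normr_ge0 J; lra.
(* At this [t], with [D = |J| + 1], the polynomial is a positive square times the negative number
   [J - 2 * D]. *)
have := H (- I / (2 * (`|J| + 1))).
set D := `|J| + 1 in J0 *.
have -> : - I / (2 * D) * I + (- I / (2 * D)) ^+ 2 * J = (I / (2 * D)) ^+ 2 * (J - 2 * D).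
  by field; rewrite gt_eqF.
rewrite pmulr_rge0; last by rewrite exprn_even_gt0//= mulf_neq0// invr_eq0 mulf_neq0// gt_eqF.
by have := ler_norm J; rewrite /D; have := normr_ge0 J; lra.
Qed.

Section sign.
Context d (T : measurableType d) (R : realType).
Implicit Type r : T -> R.

Definition pmsign r x : R := if 0 < r x then 1 else -1.

Lemma pmsign_mul r x : pmsign r x * r x = `|r x|.
Proof.
rewrite /pmsign; case: ltP => r0; first by rewrite mul1r gtr0_norm.
by rewrite mulN1r ler0_norm.
Qed.

Lemma pmsign_le1 r x : `|pmsign r x| <= 1.
Proof. by rewrite /pmsign; case: ifP; rewrite ?normrN normr1. Qed.

Lemma measurable_pmsign r : measurable_fun setT r -> measurable_fun setT (pmsign r).
Proof.
move=> mr; apply: measurable_fun_if => //.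
exact: measurable_fun_ltr.
Qed.

End sign.

Section stationarity.
Context d1 d2 (X : measurableType d1) (Y : measurableType d2) (R : realType).
Variables (mu : {finite_measure set X -> \bar R})
  (nu : {finite_measure set Y -> \bar R}).
Local Notation P := (mu \x nu)%E.
Variables (gamma delta : R) (c : X * Y -> R) (f1 : X -> R) (f2 : Y -> R).
Hypotheses (gamma_gt0 : 0 < gamma) (delta_gt0 : 0 < delta).
Hypotheses (Lc : sqintegrable P c) (Lf1 : sqintegrable mu f1)
  (Lf2 : sqintegrable nu f2).
Hypotheses (f1_ge : forall x, delta <= f1 x) (f2_ge : forall y, delta <= f2 y).
Hypotheses (f1_int : \int[mu]_x f1 x = 1) (f2_int : \int[nu]_y f2 y = 1).
Local Notation adm := (dual_admissible mu nu gamma c f1 f2).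
Local Notation val := (dual_value mu nu gamma c f1 f2).
Local Notation dens := (dual_density gamma c f1 f2).
Local Notation k := (ref_plan gamma f1 f2).

Variables (a : X -> R) (b : Y -> R).
Hypothesis (Aab : adm a b).
Hypothesis (ab_min : forall a' b', adm a' b' -> val a b <= val a' b').

Let sp z := pos_part (slack c a b z).
(** Derivative of the dual integrand with respect to the slack. *)
Let w z := sp z - k z.

Let k_ge0 z : 0 <= k z. Proof. exact: (ref_plan_ge0 gamma_gt0 delta_gt0 f1_ge f2_ge). Qed.

Let Lk : sqintegrable P k := sqintegrable_ref_plan gamma Lf1 Lf2.

Let ma : measurable_fun setT a. Proof. by case: Aab. Qed.
Let mb : measurable_fun setT b. Proof. by case: Aab. Qed.
Let Iab : rintegrable P (dens a b). Proof. by case: Aab. Qed.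
Let ms := measurable_slack Lc ma mb.

Let Lsp : sqintegrable P sp.
Proof.
apply: (sqintegrable_dom _ (rintegrableD (rintegrableZ 4 Iab) (rintegrableZ 2 Lk.2))).
  exact: measurable_maxr.
by move=> z; exact: pos_part_sqr_coercive.
Qed.

Let Lw : sqintegrable P w. Proof. exact: sqintegrableB. Qed.

(** For bounded directions the quadratic upper bound [dual_integrand_le] keeps the perturbed pair
    admissible; minimality then makes a polynomial [t * I + t ^+ 2 * J] nonnegative for all [t]. *)
Lemma dual_stationary (p : X -> R) (q : Y -> R) :
  measurable_fun setT p -> measurable_fun setT q ->
  (forall x, `|p x| <= 1) -> (forall y, `|q y| <= 1) ->
  \int[P]_z (w z * (p z.1 - q z.2)) = 0.
Proof.
move=> mp mq p1 q1; pose h (z : X * Y) := p z.1 - q z.2.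
have mh : measurable_fun setT h.
  by apply: measurable_funB; exact: measurableT_comp.
have h2 z : `|h z| <= 2.
  by rewrite (le_trans (ler_normB _ _))//; have := p1 z.1; have := q1 z.2; lra.
have Lh : sqintegrable P h.
  apply: (sqintegrable_dom mh (rintegrable_prod_cst mu nu 4)) => z.
  by have := h2 z; rewrite ler_norml => /andP[]; nra.
apply: (@quadratic_ge0_eq0 _ _ (2^-1 * \int[P]_z (h z ^+ 2))) => t.
pose a' x := a x + t * p x; pose b' y := b y + t * q y.
have ma' : measurable_fun setT a' by apply: measurable_funD => //; exact: measurable_funM.
have mb' : measurable_fun setT b' by apply: measurable_funD => //; exact: measurable_funM.
pose ub z := dens a b z + (t * (w z * h z) + t ^+ 2 * (2^-1 * h z ^+ 2)).
have Iwh : rintegrable P (fun z => w z * h z) by exact: sqintegrableM.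
have Ih2 : rintegrable P (fun z => 2^-1 * h z ^+ 2) by apply: rintegrableZ; exact: Lh.2.
have Iub : rintegrable P ub.
  by apply: rintegrableD => //; apply: rintegrableD; exact: rintegrableZ.
have le_ub z : dens a' b' z <= ub z.
  have := dual_integrand_le (k z) (slack c a b z) (t * h z).
  have -> : slack c a b z + t * h z = slack c a' b' z.
    by rewrite /slack /a' /b' /h; lra.
  move/le_trans; apply; rewrite /ub /dual_density -addrA lerD2l /w /sp.
  by rewrite exprMn; lra.
have Iab' : rintegrable P (dens a' b').
  apply: (rintegrable_dom _ Iub).
    exact: (measurable_dual_density gamma Lc Lf1 Lf2 ma' mb').
  by move=> z; rewrite ger0_norm// (dual_density_ge0 c gamma_gt0 delta_gt0 f1_ge f2_ge).
have : val a b <= \int[P]_z ub z.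
  by apply: le_trans (ab_min _) _; [split; [exact: ma'|exact: mb'|]|exact: le_Rint].
rewrite Rint_D//; last by apply: rintegrableD; exact: rintegrableZ.
rewrite lerDl Rint_D; [|exact: rintegrableZ|exact: rintegrableZ].
rewrite Rint_Z// Rint_Z// Rint_Z//.
exact: Lh.2.
Qed.

Let Iw := sqintegrable_prod_rintegrable Lw.
Let Isp := sqintegrable_prod_rintegrable Lsp.

(** Perturbing [a] by the sign of the residual [r] shows that [|r|] has integral 0. As [f2] has
    integral 1, [r x] is a.e. the integral of the positive part minus [gamma * f1 x]. *)
Lemma dual_marginal1 : {ae mu, forall x,
  (\int[nu]_y (pos_part (a x - b y - c (x, y)))%:E = (gamma * f1 x)%:E)%E}.
Proof.
pose r x := \int[nu]_y w (x, y).
have Ir : rintegrable mu r := rintegrable_Rint1 Iw.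
have mr := measurable_rintegrable Ir.
have mp := measurable_pmsign mr.
have r0 : \int[mu]_x `|r x| = 0.
  have := @dual_stationary (pmsign r) (fun=> 0) mp (measurable_cst _) (pmsign_le1 r).
  move=> /(_ (fun _ => ltac:(by rewrite normr0))) <-.
  rewrite Rint_fubini1; last first.
    apply: (rintegrable_dom _ (rintegrable_norm Iw)).
      apply: measurable_funM; first exact: Lw.1.
      by apply: measurable_funB => //; exact: measurableT_comp.
    by move=> z; rewrite normrM subr0 ler_piMr// pmsign_le1.
  apply: ae_eq_Rint; first exact: measurableT_comp.
    apply: measurable_rintegrable; apply: (@rintegrable_Rint1 _ _ _ _ _ mu nu
      (fun z => w z * (pmsign r z.1 - 0))).
    apply: (rintegrable_dom _ (rintegrable_norm Iw)).
      apply: measurable_funM; first exact: Lw.1.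
      by apply: measurable_funB => //; exact: measurableT_comp.
    by move=> z; rewrite normrM subr0 ler_piMr// pmsign_le1.
  apply: filterS (rintegrable_section1 Iw) => x Ix /=.
  rewrite -pmsign_mul /r -Rint_Z//; apply: eq_Rintegral => y _.
  by rewrite subr0 mulrC.
have := ge0_Rint_eq0 (rintegrable_norm Ir) (fun x => normr_ge0 _) r0.
apply: filterS2 (rintegrable_section1 Isp) => x Ix /eqP; rewrite normr_eq0 => /eqP rx.
have If2 := sqintegrable_rintegrable Lf2.
have kE : (fun y => k (x, y)) = fun y => gamma * f1 x * f2 y.
  by apply/funext => y; rewrite /ref_plan mulrA.
have Ik : rintegrable nu (fun y => k (x, y)) by rewrite kE; exact: rintegrableZ.
have kint : \int[nu]_y k (x, y) = gamma * f1 x.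
  by rewrite kE Rint_Z// f2_int mulr1.
rewrite (RintegralE_EFin Ix); congr EFin; rewrite -kint.
by apply/eqP; rewrite -subr_eq0 -Rint_B//; apply/eqP.
Qed.

Lemma dual_marginal2 : {ae nu, forall y,
  (\int[mu]_x (pos_part (a x - b y - c (x, y)))%:E = (gamma * f2 y)%:E)%E}.
Proof.
pose r y := \int[mu]_x w (x, y).
have Ir : rintegrable nu r := rintegrable_Rint2 Iw.
have mr := measurable_rintegrable Ir.
have mp := measurable_pmsign mr.
(* [b] enters the slack with a minus sign, so [v] integrates to minus the integral of [|r|]. *)
pose v (z : X * Y) := w z * (0 - pmsign r z.2).
have Iv : rintegrable P v.
  apply: (rintegrable_dom _ (rintegrable_norm Iw)).
    apply: measurable_funM; first exact: Lw.1.
    by apply: measurable_funB => //; exact: measurableT_comp.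
  by move=> z; rewrite normrM sub0r normrN ler_piMr// pmsign_le1.
have r0 : \int[nu]_y `|r y| = 0.
  apply/eqP; rewrite -oppr_eq0 -Rint_N; last exact: rintegrable_norm.
  have := @dual_stationary (fun=> 0) (pmsign r) (measurable_cst _) mp.
  move=> /(_ (fun _ => ltac:(by rewrite normr0)) (pmsign_le1 r)) <-.
  apply/eqP; rewrite Rint_fubini2//.
  apply: ae_eq_Rint; first by do 2 apply: measurableT_comp => //.
    exact: measurable_rintegrable (rintegrable_Rint2 Iv).
  apply: filterS (rintegrable_section2 Iw) => y Iy /=.
  rewrite -pmsign_mul -mulNr /r -Rint_Z//; apply: eq_Rintegral => x _.
  by rewrite sub0r mulrC.
have := ge0_Rint_eq0 (rintegrable_norm Ir) (fun x => normr_ge0 _) r0.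
apply: filterS2 (rintegrable_section2 Isp) => y Iy /eqP; rewrite normr_eq0 => /eqP ry.
have If1 := sqintegrable_rintegrable Lf1.
have kE : (fun x => k (x, y)) = fun x => gamma * f2 y * f1 x.
  by apply/funext => x; rewrite /ref_plan /= [f1 x * _]mulrC mulrA.
have Ik : rintegrable mu (fun x => k (x, y)) by rewrite kE; exact: rintegrableZ.
have kint : \int[mu]_x k (x, y) = gamma * f2 y.
  by rewrite kE Rint_Z// f1_int mulr1.
rewrite (RintegralE_EFin Iy); congr EFin; rewrite -kint.
by apply/eqP; rewrite -subr_eq0 -Rint_B//; apply/eqP.
Qed.

End stationarity.

(** * Square integrability of the potentials *)

Section potential_regularity.
Context d1 d2 (X : measurableType d1) (Y : measurableType d2) (R : realType).
Variables (mu : {finite_measure set X -> \bar R})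
  (nu : {finite_measure set Y -> \bar R}).
Local Notation P := (mu \x nu)%E.

(** Dominated convergence: the positive parts tend to 0 pointwise and are bounded by [|b|]. *)
Lemma pos_part_tail (b : Y -> R) (e : R) : rintegrable nu b -> 0 < e ->
  exists n : nat, \int[nu]_y pos_part (b y - n%:R) < e.
Proof.
move=> Ib e0; have mb := measurable_rintegrable Ib.
pose f n y := pos_part (b y - n%:R).
have mf n : measurable_fun setT (f n).
  by apply: measurable_maxr => //; exact: measurable_funB.
have fb n y : `|f n y| <= `|b y|.
  rewrite ger0_norm ?pos_part_ge0// (le_trans _ (pos_part_norm _))//.
  by apply: pos_part_le; rewrite lerBlDr lerDl.
have If n : rintegrable nu (f n) := rintegrable_dom (mf n) (rintegrable_norm Ib) (fb n).
have f0 : {ae nu, forall y, setT y -> (f n y)%:E @[n --> \oo] --> (cst 0%E y : \bar R)}.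
  apply: aeW => y _; apply: cvg_near_cst; near=> n; congr EFin.
  by apply: le0_pos_part; rewrite subr_le0; near: n; exact: nbhs_infty_ger.
have fdom : {ae nu, forall y n, setT y -> (`|(f n y)%:E| <= `|b y|%:E)%E}.
  by apply: aeW => y n _; rewrite /= lee_fin fb.
have [_ _] := dominated_convergence measurableT
  (fun n => (measurable_EFinP _ _).2 (mf n)) (measurable_cst _) f0
  (rintegrable_norm Ib) fdom.
rewrite integral0 => /fine_cvgP [_].
move=> /cvgr_lt /(_ e e0) [n _ /(_ n (leqnn n))] /= H.
by exists n.
Unshelve. all: by end_near. Qed.

Variables (gamma delta clow : R) (c : X * Y -> R) (f : X -> R).
Hypotheses (gamma_gt0 : 0 < gamma) (delta_gt0 : 0 < delta).
Hypotheses (Lc : sqintegrable P c) (Lf : sqintegrable mu f).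
Hypotheses (f_ge : forall x, delta <= f x) (c_ge : forall z, clow <= c z).
Hypothesis nu_gt0 : 0 < fine (nu setT).

(** From above, integrating [t <= pos_part t] over [y] gives [a x <= U x]. From below, if
    [a x < - n] the positive part would integrate to less than [gamma * delta], against the marginal
    equation. *)
Lemma sqintegrable_potential (a : X -> R) (b : Y -> R) :
  measurable_fun setT a -> rintegrable nu b ->
  {ae mu, forall x,
    (\int[nu]_y (pos_part (a x - b y - c (x, y)))%:E = (gamma * f x)%:E)%E} ->
  sqintegrable mu a.
Proof.
move=> ma Ib eqs; have mb := measurable_rintegrable Ib.
have Ig : rintegrable nu (fun y => - b y - clow).
  by apply: rintegrableB; [exact: rintegrableN|exact: rintegrable_cst].
have [n Hn] := pos_part_tail Ig (mulr_gt0 gamma_gt0 delta_gt0).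
pose U x := (fine (nu setT))^-1 *
  (gamma * f x + \int[nu]_y b y + \int[nu]_y c (x, y)).
have LU : sqintegrable mu U.
  apply: sqintegrableZ; apply: sqintegrableD; last exact: sqintegrable_Rint1.
  by apply: sqintegrableD; [exact: sqintegrableZ|exact: sqintegrable_cst].
(* The clamped function is everywhere controlled by [n] and [U], and a.e. it is [a] itself. The
   outer maximum settles the points where [U x < - n]. *)
pose F x := Num.max (- n%:R) (Num.min (a x) (U x)).
have mF : measurable_fun setT F.
  by apply: measurable_maxr => //; apply: measurable_minr => //; exact: LU.1.
apply: (@ae_sqintegrable _ _ _ _ F) => //; last first.
  have L2 := rintegrableD (rintegrable_cst mu (n%:R ^+ 2)) LU.2.
  apply: (sqintegrable_dom mF L2) => x.
  have n0 : 0 <= n%:R :> R by [].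
  have Fn : - n%:R <= F x by rewrite /F le_max lexx.
  have [Fx|Fx] : F x = - n%:R \/ F x <= U x.
  - have [h|h] := leP (Num.min (a x) (U x)) (- n%:R).
      by left; rewrite /F (max_idPl h).
    by right; rewrite /F (max_idPr (ltW h)) ge_min lexx orbT.
  - by rewrite Fx sqrrN lerDl sqr_ge0.
  - by have [?|?] := leP 0 (F x); nra.
have Ic := sqintegrable_prod_rintegrable Lc.
apply: filterS2 eqs (rintegrable_section1 Ic) => x eqx Icx.
have Is : rintegrable nu (fun y => a x - b y - c (x, y)).
  by apply: rintegrableB => //; apply: rintegrableB => //; exact: rintegrable_cst.
have Isp : rintegrable nu (fun y => pos_part (a x - b y - c (x, y))).
  apply: (rintegrable_dom _ (rintegrable_norm Is)).
    by apply: measurable_maxr => //; exact: measurable_rintegrable Is.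
  by move=> y; rewrite ger0_norm ?pos_part_ge0// pos_part_norm.
move: eqx; rewrite (RintegralE_EFin Isp) => -[eqx].
have aU : a x <= U x.
  rewrite /U ler_pdivlMl// mulrC -Rint_cst.
  have := le_Rint Is Isp (fun y => pos_part_ge _).
  rewrite eqx Rint_B//; last by apply: rintegrableB => //; exact: rintegrable_cst.
  rewrite Rint_B//; last exact: rintegrable_cst.
  by lra.
have an : - n%:R <= a x.
  rewrite leNgt; apply/negP => ax; move: Hn; rewrite ltNge => /negP; apply.
  apply: le_trans (ler_wpM2l (ltW gamma_gt0) (f_ge x)) _; rewrite -eqx.
  have Ign : rintegrable nu (fun y => - b y - clow - n%:R).
    by apply: rintegrableB => //; exact: rintegrable_cst.
  apply: le_Rint => //.
    apply: (rintegrable_dom _ (rintegrable_norm Ign)).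
      by apply: measurable_maxr => //; exact: measurable_rintegrable Ign.
    by move=> y; rewrite ger0_norm ?pos_part_ge0// pos_part_norm.
  by move=> y; apply: pos_part_le; have := c_ge (x, y); lra.
by rewrite /F (min_idPl aU) (max_idPr an).
Qed.

End potential_regularity.

(** * Optimality on finite measure spaces *)

Section finite_transport.
Context d1 d2 (X : measurableType d1) (Y : measurableType d2) (R : realType).
Variables (mu : {finite_measure set X -> \bar R})
  (nu : {finite_measure set Y -> \bar R}).
Local Notation P := (mu \x nu)%E.
Variables (gamma : R) (c : X * Y -> R) (f1 : X -> R) (f2 : Y -> R).
Hypothesis gamma_gt0 : 0 < gamma.
Hypothesis Lc : sqintegrable P c.
Implicit Types p : X * Y -> R.

Definition has_marginals p :=
  {ae mu, forall x, (\int[nu]_y (p (x, y))%:E = (f1 x)%:E)%E} /\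
  {ae nu, forall y, (\int[mu]_x (p (x, y))%:E = (f2 y)%:E)%E}.

Definition transport_plan p :=
  [/\ sqintegrable P p, has_marginals p & {ae P, forall z, 0 <= p z}].

Definition transport_cost p : R :=
  \int[P]_z (c z * p z) + gamma / 2 * \int[P]_z (p z ^+ 2).

Lemma transport_plan_ae p q : measurable_fun setT q ->
  {ae P, forall z, p z = q z} -> transport_plan p -> transport_plan q.
Proof.
move=> mq pq [Lp [p1 p2] p0]; have mp := Lp.1; split.
- exact: ae_sqintegrable pq Lp.
- split.
    apply: filterS2 (ae_section1 pq) p1 => x pqx <-.
    apply: ae_eq_integral => //; try exact/measurable_EFinP/measurable_section1.
    by apply: filterS pqx => y ->.
  apply: filterS2 (ae_section2 pq) p2 => y pqy <-.
  apply: ae_eq_integral => //; try exact/measurable_EFinP/measurable_section2.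
  by apply: filterS pqy => x ->.
- by apply: filterS2 pq p0 => z <-.
Qed.

Lemma transport_cost_ae p q : measurable_fun setT p -> measurable_fun setT q ->
  {ae P, forall z, p z = q z} -> transport_cost p = transport_cost q.
Proof.
move=> mp mq pq; congr (_ + _ * _); apply: ae_eq_Rint.
- by apply: measurable_funM => //; exact: Lc.1.
- by apply: measurable_funM => //; exact: Lc.1.
- by apply: filterS pq => z ->.
- exact: measurable_funX.
- exact: measurable_funX.
- by apply: filterS pq => z ->.
Qed.

(** Equal marginals make [p - q] orthogonal to functions of [x] alone and of [y] alone; each summand
    is integrated in the matching order. *)
Lemma Rint_mul_oplus (a1 : X -> R) (a2 : Y -> R) p q :
  sqintegrable mu a1 -> sqintegrable nu a2 ->
  sqintegrable P p -> sqintegrable P q -> has_marginals p -> has_marginals q ->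
  \int[P]_z (oplus a1 a2 z * (p z - q z)) = 0.
Proof.
move=> L1 L2 Lp Lq [p1 p2] [q1 q2].
have LD := sqintegrableB Lp Lq.
have I1 : rintegrable P (fun z => a1 z.1 * (p z - q z)).
  exact: sqintegrableM (sqintegrable_fst nu L1) LD.
have I2 : rintegrable P (fun z => a2 z.2 * (p z - q z)).
  exact: sqintegrableM (sqintegrable_snd mu L2) LD.
under eq_Rintegral do rewrite mulrDl.
rewrite Rint_D// Rint_fubini1// [X in _ + X]Rint_fubini2//.
have Ip := sqintegrable_prod_rintegrable Lp.
have Iq := sqintegrable_prod_rintegrable Lq.
have -> : \int[mu]_x \int[nu]_y (a1 x * (p (x, y) - q (x, y))) = \int[mu]_x (0 : R).
  apply: ae_eq_Rint => //; first exact: measurable_rintegrable (rintegrable_Rint1 I1).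
  apply: filterS3 (rintegrable_section1 Ip) (rintegrable_section1 Iq)
    (filterI p1 q1) => x Ipx Iqx [].
  rewrite (RintegralE_EFin Ipx) (RintegralE_EFin Iqx) => -[px] [qx].
  by rewrite Rint_Z ?Rint_B ?px ?qx ?subrr ?mulr0//; exact: rintegrableB.
have -> : \int[nu]_y \int[mu]_x (a2 y * (p (x, y) - q (x, y))) = \int[nu]_y (0 : R).
  apply: ae_eq_Rint => //; first exact: measurable_rintegrable (rintegrable_Rint2 I2).
  apply: filterS3 (rintegrable_section2 Ip) (rintegrable_section2 Iq)
    (filterI p2 q2) => y Ipy Iqy [].
  rewrite (RintegralE_EFin Ipy) (RintegralE_EFin Iqy) => -[py] [qy].
  by rewrite Rint_Z ?Rint_B ?py ?qy ?subrr ?mulr0//; exact: rintegrableB.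
by rewrite !Rint_cst !mul0r addr0.
Qed.

(** Expanding the squares, the difference of the two sides is the integral of
    [(c + gamma p) (q - p)], from which [Rint_mul_oplus] allows the potentials to be subtracted. The
    remaining integrand is nonnegative by complementary slackness. *)
Lemma transport_cost_gap (a1 : X -> R) (a2 : Y -> R) p q :
  sqintegrable mu a1 -> sqintegrable nu a2 ->
  transport_plan p -> transport_plan q ->
  {ae P, forall z, p z = gamma^-1 * pos_part (oplus a1 a2 z - c z)} ->
  transport_cost p + gamma / 2 * \int[P]_z ((q z - p z) ^+ 2) <= transport_cost q.
Proof.
move=> L1 L2 [Lp mp p0] [Lq mq q0] pE.
have W0 := Rint_mul_oplus L1 L2 Lq Lp mq mp.
have LW : sqintegrable P (oplus a1 a2).
  exact: sqintegrableD (sqintegrable_fst nu L1) (sqintegrable_snd mu L2).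
have LD := sqintegrableB Lq Lp.
have IWD := sqintegrableM LW LD.
have Icp := sqintegrableM Lc Lp.
have Icq := sqintegrableM Lc Lq.
have Ip2 := rintegrableZ (gamma / 2) Lp.2.
have Iq2 := rintegrableZ (gamma / 2) Lq.2.
have ID2 := rintegrableZ (gamma / 2) LD.2.
rewrite /transport_cost -(Rint_Z _ Lp.2) -(Rint_Z _ Lq.2) -(Rint_Z _ LD.2).
rewrite -Rint_D// -Rint_D//; last exact: rintegrableD.
rewrite -Rint_D// -[leLHS]addr0 -W0 -Rint_D//; last first.
  by apply: rintegrableD => //; exact: rintegrableD.
apply: ae_le_Rint; [| exact: rintegrableD |].
  by apply: rintegrableD => //; apply: rintegrableD => //; exact: rintegrableD.
apply: filterS2 pE q0 => z pz qz.
set u := oplus a1 a2 z - c z in pz.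
have -> : oplus a1 a2 z = u + c z by rewrite /u subrK.
have gp : gamma * p z = pos_part u by rewrite pz mulrA divff ?gt_eqF// mul1r.
have p_ge0 : 0 <= p z by rewrite pz mulr_ge0 ?pos_part_ge0// invr_ge0 ltW.
suff : 0 <= (gamma * p z - u) * (q z - p z) by lra.
(* For [u >= 0] the first factor vanishes; for [u <= 0] one has [p z = 0], and both [- u] and [q z]
   are nonnegative. *)
rewrite gp; have [[u0 uE]|[u0 uE]] := pos_partP u; first by rewrite uE subrr mul0r.
have -> : p z = 0 by rewrite pz uE mulr0.
by rewrite uE sub0r subr0 mulr_ge0// oppr_ge0.
Qed.

End finite_transport.

Section finite_transport_optimality.
Context d1 d2 (X : measurableType d1) (Y : measurableType d2) (R : realType).
Variables (mu : {finite_measure set X -> \bar R})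
  (nu : {finite_measure set Y -> \bar R}).
Local Notation P := (mu \x nu)%E.
Variables (gamma delta clow : R) (c : X * Y -> R) (f1 : X -> R) (f2 : Y -> R).
Hypotheses (gamma_gt0 : 0 < gamma) (delta_gt0 : 0 < delta).
Hypotheses (Lc : sqintegrable P c) (Lf1 : sqintegrable mu f1)
  (Lf2 : sqintegrable nu f2).
Hypotheses (f1_ge : forall x, delta <= f1 x) (f2_ge : forall y, delta <= f2 y).
Hypothesis c_ge : forall z, clow <= c z.
Hypotheses (f1_int : \int[mu]_x f1 x = 1) (f2_int : \int[nu]_y f2 y = 1).

Definition dual_solution (a1 : X -> R) (a2 : Y -> R) :=
  [/\ sqintegrable mu a1, sqintegrable nu a2,
   {ae mu, forall x, (\int[nu]_y (pos_part (oplus a1 a2 (x, y) - c (x, y)))%:E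
      = (gamma * f1 x)%:E)%E} &
   {ae nu, forall y, (\int[mu]_x (pos_part (oplus a1 a2 (x, y) - c (x, y)))%:E
      = (gamma * f2 y)%:E)%E}].

Lemma dual_solution_exists : exists a1 a2, dual_solution a1 a2.
Proof.
have [a [b [Aab ab_min]]] := dual_minimizer gamma_gt0 delta_gt0 Lc Lf1 Lf2
  f1_ge f2_ge f1_int f2_int.
have [ma mb _] := Aab.
have Ia := admissible_rintegrable1 gamma_gt0 delta_gt0 Lc Lf1 Lf2 f1_ge f2_ge f2_int Aab.
have Ib := admissible_rintegrable2 gamma_gt0 delta_gt0 Lc Lf1 Lf2 f1_ge f2_ge f1_int Aab.
have eq1 := dual_marginal1 gamma_gt0 delta_gt0 Lc Lf1 Lf2 f1_ge f2_ge f2_int Aab ab_min.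
have eq2 := dual_marginal2 gamma_gt0 delta_gt0 Lc Lf1 Lf2 f1_ge f2_ge f1_int Aab ab_min.
have mu_gt0 := finite_mass_gt0 Lf1.1 f1_int.
have nu_gt0 := finite_mass_gt0 Lf2.1 f2_int.
exists a, (fun y => - b y); split => //.
- exact: (sqintegrable_potential gamma_gt0 delta_gt0 Lc Lf1 f1_ge c_ge nu_gt0 ma Ib eq1).
(* After exchanging the two factors, [- b] solves the same kind of equation, with [- a] in the role
   of [b]. *)
- have Lc' : sqintegrable (nu \x mu)%E (fun z => c (z.2, z.1)).
    split; last exact: (rintegrable_swap Lc.2).
    by apply: (measurableT_comp Lc.1); exact: measurable_fun_pair.
  apply: (sqintegrable_potential gamma_gt0 delta_gt0 Lc' Lf2 f2_ge _ mu_gt0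
    _ (rintegrableN Ia)).
  + by move=> z; exact: c_ge.
  + exact: measurableT_comp.
  + apply: filterS eq2 => y <-; apply: eq_integral => x _.
    by rewrite opprK [- b y + _]addrC.
Qed.

Lemma dual_solution_plan a1 a2 : dual_solution a1 a2 ->
  transport_plan mu nu f1 f2
    (fun z => gamma^-1 * pos_part (oplus a1 a2 z - c z)).
Proof.
move=> [L1 L2 eq1 eq2].
have LW : sqintegrable P (oplus a1 a2).
  exact: sqintegrableD (sqintegrable_fst nu L1) (sqintegrable_snd mu L2).
have Lp := sqintegrable_pos_part (sqintegrableB LW Lc).
have gK r : ((gamma^-1)%:E * (gamma * r)%:E = r%:E)%E.
  by rewrite -EFinM mulrA mulVf ?gt_eqF// mul1r.
split; [exact: sqintegrableZ| |]; last first.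
  by apply: aeW => z; rewrite mulr_ge0 ?pos_part_ge0// invr_ge0 ltW.
split; [apply: filterS eq1 => x eqx|apply: filterS eq2 => x eqx].
  under eq_integral do rewrite EFinM.
  rewrite ge0_integralZl_EFin ?invr_ge0 ?(ltW gamma_gt0)//.
  - by rewrite eqx gK.
  - by move=> y _; rewrite lee_fin pos_part_ge0.
  - by apply/measurable_EFinP; exact: (measurable_section1 _ Lp.1).
under eq_integral do rewrite EFinM.
rewrite ge0_integralZl_EFin ?invr_ge0 ?(ltW gamma_gt0)//.
- by rewrite eqx gK.
- by move=> y _; rewrite lee_fin pos_part_ge0.
- by apply/measurable_EFinP; exact: (measurable_section2 _ Lp.1).
Qed.

Lemma transport_optimality p : measurable_fun setT p ->
  (transport_plan mu nu f1 f2 p /\ forall q, transport_plan mu nu f1 f2 q ->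
     transport_cost mu nu gamma c p <= transport_cost mu nu gamma c q) <->
  exists a1 a2, dual_solution a1 a2 /\
    {ae P, forall z, p z = gamma^-1 * pos_part (oplus a1 a2 z - c z)}.
Proof.
move=> mp; split.
  move=> [Tp p_min]; have [a1 [a2 a12]] := dual_solution_exists.
  exists a1, a2; split => //.
  pose q z := gamma^-1 * pos_part (oplus a1 a2 z - c z).
  have Tq : transport_plan mu nu f1 f2 q := dual_solution_plan a12.
  have [L1 L2 _ _] := a12.
  (* [q] is cheaper than [p] by at least [gamma / 2] times their squared distance, while [p] is
     optimal: the distance is 0. *)
  have gap := transport_cost_gap gamma_gt0 Lc L1 L2 Tq Tp (aeW _ (fun=> erefl)).
  have [Lp _ _] := Tp; have [Lq _ _] := Tq.
  have I2 := (sqintegrableB Lp Lq).2.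
  have : \int[P]_z ((p z - q z) ^+ 2) = 0.
    apply/eqP; rewrite eq_le; apply/andP; split; last first.
      by apply: Rintegral_ge0 => z _; exact: sqr_ge0.
    rewrite -(pmulr_rle0 _ (divr_gt0 gamma_gt0 (ltr0Sn R 1))).
    by have := p_min _ Tq; lra.
  move=> /(ge0_Rint_eq0 I2 (fun z => sqr_ge0 _)); apply: filterS => z /eqP.
  by rewrite sqrf_eq0 subr_eq0 => /eqP.
move=> [a1 [a2 [a12 pE]]]; have [L1 L2 _ _] := a12.
have Tp : transport_plan mu nu f1 f2 p.
  apply: transport_plan_ae mp _ (dual_solution_plan a12).
  by apply: filterS pE => z ->.
split => // q Tq; have := transport_cost_gap gamma_gt0 Lc L1 L2 Tp Tq pE.
apply: le_trans; rewrite lerDl mulr_ge0 ?divr_ge0 ?(ltW gamma_gt0)//.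
by apply: Rintegral_ge0 => z _; exact: sqr_ge0.
Qed.

End finite_transport_optimality.

(** * Restriction to compact domains *)

Section compact_rV.
Context {R : realType} {n : nat}.
Implicit Types (x : 'rV[R]_n) (A : set 'rV[R]_n).

Lemma ball_rVE x e : 0 < e ->
  ball x e = [set y | forall i, ball (x ord0 i) e (y ord0 i)] :> set 'rV[R]_n.
Proof.
move=> e0; apply/seteqP; split => y /=; first by move=> [_ xy] i; exact: xy.
by move=> xy; split => // i j; rewrite (ord1 i); exact: xy.
Qed.

Lemma measurable_ball_rV x e : 0 < e -> measurable (ball x e).
Proof.
move=> e0; rewrite ball_rVE// [X in measurable X](_ : _ = \bigcap_(i in [set: 'I_n])
  ((fun y : 'rV[R]_n => y ord0 i) @^-1` ball (x ord0 i) e)); last first.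
  by apply/seteqP; split => y /= H i; [move=> _|]; apply: H.
apply: fin_bigcap_measurable => // i _; rewrite -[X in measurable X]setTI.
by apply: measurable_coord_rV => //; exact: measurable_ball.
Qed.

(** The sigma-algebra is generated by the coordinates, and balls are measurable as boxes. A compact
    set is the intersection over [k] of finite unions of balls of radius [1 / (k + 1)] centered in
    it. *)
Lemma compact_rV_measurable A : compact A -> measurable A.
Proof.
move=> cA; have clA : closed A by apply: compact_closed => //; exact: norm_hausdorff.
have cov (k : nat) : exists D : set 'rV[R]_n, [/\ finite_set D, D `<=` A &
    A `<=` cover D (fun x => ball x k.+1%:R^-1)].
  move: cA; rewrite compact_cover => /(_ _ A (fun x => ball x k.+1%:R^-1)) [].
  - by move=> x _; exact: ball_open.
  - by move=> x Ax; exists x => //; apply: ballxx; rewrite invr_gt0.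
  - move=> D sD cD; eexists; split; [| |exact: cD]; first exact: finite_fset.
    by move=> x /= /sD /set_mem.
have [D HD] := choice cov.
rewrite [X in measurable X](_ : _ =
    \bigcap_k cover (D k) (fun x => ball x k.+1%:R^-1)).
  apply: bigcapT_measurable => k; apply: fin_bigcup_measurable; first by have [] := HD k.
  move=> x _.
  by apply: measurable_ball_rV; rewrite invr_gt0.
apply/seteqP; split => x; first by move=> Ax k _; by have [_ _] := HD k; exact.
move=> Hx; apply: clA => U /nbhs_ballP [e /= e0 eU].
have [k ke] : exists k : nat, k.+1%:R^-1 < e.
  have := near_infty_natSinv_lt (PosNum e0) => -[k _ /(_ k (leqnn k))] /= ke.
  by exists k.
have [y yD xy] := Hx k I; exists y; split; first by have [_ + _] := HD k; exact.
by apply: eU; apply: le_ball (ltW ke) _ _; exact: ball_sym.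
Qed.

Lemma compact_rV_finite A : compact A -> (lebesgue_rV R n A < +oo)%E.
Proof.
move=> cA; have [M [_ HM]] := compact_bounded cA.
(* Norms on [A] are bounded by every number above [M], in particular by [|M| + 1], which leaves a
   strict margin below [r]. *)
pose r := `|M| + 2.
have r0 : 0 < r by rewrite ltr_wpDl.
have Ar : A `<=` ball (0 : 'rV[R]_n) r.
  move=> x Ax; rewrite mx_norm_ball /ball_ /= sub0r normrN.
  have := HM (`|M| + 1) _ x Ax; rewrite (le_lt_trans (ler_norm M)) ?ltrDl//.
  by move=> /(_ isT) /le_lt_trans; apply; rewrite /r; lra.
have mA := compact_rV_measurable cA.
apply: (@le_lt_trans _ _ (lebesgue_rV R n (ball (0 : 'rV[R]_n) r))).
  have mB := measurable_ball_rV (0 : 'rV[R]_n) r0.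
  exact: (le_measure (lebesgue_rV R n) (mem_set mA) (mem_set mB) Ar).
have /= := @lebesgue_rV_box R n (fun i => ball ((0 : 'rV[R]_n) ord0 i) r).
rewrite ball_rVE// => ->; last by move=> i; exact: measurable_ball.
under eq_bigr do rewrite lebesgue_measure_ball ?(ltW r0)//.
by rewrite prodEFin ltry.
Qed.

End compact_rV.

(** * Restriction of a measure to a measurable set *)

Section restricted_measure.
Context d (T : measurableType d) (R : realType).
Variables (m md : {measure set T -> \bar R}) (D : set T).
Hypothesis mD : measurable D.
Hypothesis mdE : forall A, measurable A -> md A = m (A `&` D).
Implicit Types f : T -> R.

Lemma ae_restr (Q : T -> Prop) :
  {ae m, forall x, D x -> Q x} <-> {ae md, forall x, Q x}.
Proof.
split=> -[N [mN N0 QN]].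
(* The complement of [D] is null for [md], so it may be added to the exceptional set. *)
- exists ((N `&` D) `|` ~` D); split.
  + by apply: measurableU; [exact: measurableI|exact: measurableC].
  + rewrite mdE; last by apply: measurableU; [exact: measurableI|exact: measurableC].
    rewrite setIUl setICl setU0 -setIA setIid.
    apply: (subset_measure0 _ _ _ N0) => //; exact: measurableI.
  + move=> x /= nQ; have [Dx|nDx] := pselect (D x); [left|by right].
    by split => //; apply: QN => /= /(_ Dx).
- exists (N `&` D); split; first exact: measurableI.
  + by rewrite -mdE.
  + move=> x /= /not_implyP [Dx nQ]; split => //; exact: QN.
Qed.

Lemma integral_restr (f : T -> \bar R) :
  (\int[m]_(x in D) f x = \int[md]_x (f \_ D) x)%E.
Proof.
rewrite -integral_mkcond; apply: eq_measure_integral => A mA AD.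
by rewrite mdE// setIidl.
Qed.

Lemma integral_restr_supp (f : T -> \bar R) : (forall x, ~ D x -> f x = 0%E) ->
  (\int[m]_x f x = \int[md]_x f x)%E.
Proof.
move=> f0; have fE : f \_ D = f.
  apply/funext => x; rewrite patchE; case: ifPn => //.
  by rewrite notin_setE => /f0 ->.
by rewrite -[in LHS]fE -integral_mkcond integral_restr fE.
Qed.

Lemma restrict0 f x : ~ D x -> (f \_ D) x = 0.
Proof. by move=> nDx; rewrite patchE memNset. Qed.

Lemma restrictE f x : D x -> (f \_ D) x = f x.
Proof. by move=> Dx; rewrite patchE mem_set. Qed.

Lemma Rintegral_restr f : \int[m]_(x in D) f x = \int[md]_x (f \_ D) x.
Proof.
rewrite /Rintegral integral_restr; congr fine; apply: eq_integral => x _.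
by rewrite !patchE; case: ifP.
Qed.

Lemma L2_sqintegrable f : L2 m D f <-> sqintegrable md (f \_ D).
Proof.
have E : (\int[m]_x `|((f \_ D) x ^+ 2)%:E| = \int[md]_x `|((f \_ D) x ^+ 2)%:E|)%E.
  by apply: integral_restr_supp => x nDx; rewrite restrict0// expr0n/= normr0.
split.
  move=> L2f; have := Lfun2_integrable_sqr L2f.
  move: L2f; rewrite /L2 inE => /andP[/[!inE]/= mf _].
  move=> /integrableP[m2 lty]; split => //; apply/integrableP; split => //.
  by move: lty; rewrite /= E.
move=> [mf /integrableP[m2 lty]]; rewrite /L2 inE; apply/andP; split; rewrite inE//=.
rewrite /finite_norm unlock; apply: poweR_lty.
move: lty; rewrite /= -E; congr (_ < _)%E; apply: eq_integral => x _ /=.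
by rewrite powR_mulrn// normrX.
Qed.

Lemma L2norm_sqr f : L2 m D f -> L2norm m D f ^+ 2 = \int[md]_x ((f \_ D) x ^+ 2).
Proof.
move=> L2f.
have Nfin : ('N[m]_2%:E[EFin \o f \_ D])%E \is a fin_num.
  rewrite ge0_fin_numE ?Lnorm_ge0//.
  by move: L2f; rewrite /L2 inE => /andP[_ /[!inE]].
have H := powR_Lnorm m (EFin \o f \_ D) (_ : (2 : R) != 0).
move: (H ltac:(by [])); rewrite -(fineK Nfin) /= powR_mulrn; last first.
  by rewrite fine_ge0 ?Lnorm_ge0.
move=> {}H.
rewrite /Rintegral -(integral_restr_supp (f := fun x => ((f \_ D) x ^+ 2)%:E)); last first.
  by move=> x nDx; rewrite restrict0// expr0n.
rewrite -[LHS]/(fine (_ ^+ 2)%:E) H; congr fine; apply: eq_integral => x _ /=.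
by rewrite powR_mulrn// real_normK// num_real.
Qed.

End restricted_measure.

(** The results on finite measures assume lower bounds at every point. The maximum with [r] provides
    them and alters [f] only on an [md]-null set. *)
Lemma sqintegrable_max_restr d (T : measurableType d) (R : realType)
    (m md : {measure set T -> \bar R}) (D : set T) (f : T -> R) (r : R) :
  measurable D -> (forall A, measurable A -> md A = m (A `&` D)) ->
  L2 m D f -> {ae m, forall x, D x -> r <= f x} ->
  {ae md, forall x, D x /\ Num.max ((f \_ D) x) r = f x} /\
  sqintegrable md (fun x => Num.max ((f \_ D) x) r).
Proof.
move=> mD mdE /(L2_sqintegrable mdE) Lf f_ge.
have H : {ae md, forall x, D x /\ Num.max ((f \_ D) x) r = f x}.
  apply/(ae_restr mD mdE); apply: filterS f_ge => x fx Dx.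
  by rewrite restrictE//; split => //; apply/max_idPl; exact: fx.
split => //; apply: (ae_sqintegrable _ _ Lf).
  by apply: measurable_maxr => //; exact: Lf.1.
by apply: filterS H => x [Dx ->]; rewrite restrictE.
Qed.

(** * The transport problem for Lebesgue measure restricted to the domains *)

Section restricted_transport.
Context {R : realType} {d1 d2 : nat}.
Variables (Omega1 : set 'rV[R]_d1) (Omega2 : set 'rV[R]_d2).
Local Notation Omega := (Omega1 `*` Omega2).
Local Notation l1 := (lebesgue_rV R d1).
Local Notation l2 := (lebesgue_rV R d2).
Local Notation l := (lebesgue_prod R d1 d2).
Hypotheses (mO1 : measurable Omega1) (mO2 : measurable Omega2).
Hypotheses (fO1 : (l1 Omega1 < +oo)%E) (fO2 : (l2 Omega2 < +oo)%E).

Definition leb1 : {finite_measure set 'rV[R]_d1 -> \bar R} := mfrestr mO1 fO1.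
Definition leb2 : {finite_measure set 'rV[R]_d2 -> \bar R} := mfrestr mO2 fO2.
Local Notation P := (leb1 \x leb2)%E.

Lemma leb1E A : measurable A -> leb1 A = l1 (A `&` Omega1). Proof. by []. Qed.
Lemma leb2E A : measurable A -> leb2 A = l2 (A `&` Omega2). Proof. by []. Qed.

Lemma measurable_Omega : measurable Omega. Proof. exact: measurableX. Qed.

Lemma lebPE A : measurable A -> P A = l (A `&` Omega).
Proof.
move=> mA.
(* Both measures agree on rectangles, which determines the product measure. *)
apply: (product_measure_unique (m' := mrestr l measurable_Omega)) => // B C mB mC.
rewrite /= /mrestr /lebesgue_prod -setXI product_measure1E//; exact: measurableI.
Qed.

Lemma restrict_section1 (f : 'rV[R]_d1 * 'rV[R]_d2 -> R) x : Omega1 x ->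
  (\int[l2]_(y in Omega2) (f (x, y))%:E = \int[leb2]_y ((f \_ Omega) (x, y))%:E)%E.
Proof.
move=> Ox; rewrite (integral_restr leb2E); apply: eq_integral => y _.
rewrite !patchE; case: ifPn => [/set_mem Oy|]; first by rewrite mem_set.
by rewrite notin_setE => nOy; rewrite memNset// => -[].
Qed.

Lemma restrict_section2 (f : 'rV[R]_d1 * 'rV[R]_d2 -> R) y : Omega2 y ->
  (\int[l1]_(x in Omega1) (f (x, y))%:E = \int[leb1]_x ((f \_ Omega) (x, y))%:E)%E.
Proof.
move=> Oy; rewrite (integral_restr leb1E); apply: eq_integral => x _.
rewrite !patchE; case: ifPn => [/set_mem Ox|]; first by rewrite mem_set.
by rewrite notin_setE => nOx; rewrite memNset// => -[].
Qed.

Variables (c c' : 'rV[R]_d1 * 'rV[R]_d2 -> R).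
Variables (mu1 f1 : 'rV[R]_d1 -> R) (mu2 f2 : 'rV[R]_d2 -> R).
Hypotheses (mc : measurable_fun setT (c \_ Omega)) (Lc' : sqintegrable P c').
Hypothesis cE : {ae P, forall z, Omega z /\ c' z = c z}.
Hypothesis f1E : {ae leb1, forall x, Omega1 x /\ f1 x = mu1 x}.
Hypothesis f2E : {ae leb2, forall y, Omega2 y /\ f2 y = mu2 y}.
Variable gamma : R.

Lemma feasible_restrict p :
  qrot_feasible Omega1 Omega2 mu1 mu2 p <-> transport_plan leb1 leb2 f1 f2 (p \_ Omega).
Proof.
have m1 : marginal1_eq Omega1 Omega2 p mu1 <->
    {ae leb1, forall x, (\int[leb2]_y ((p \_ Omega) (x, y))%:E = (f1 x)%:E)%E}.
  rewrite /marginal1_eq; split.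
    move=> /(ae_restr mO1 leb1E); apply: filterS2 f1E => x [Ox ->].
    by rewrite restrict_section1.
  move=> H; apply/(ae_restr mO1 leb1E); apply: filterS2 f1E H => x [Ox ->].
  by rewrite restrict_section1.
have m2 : marginal2_eq Omega1 Omega2 p mu2 <->
    {ae leb2, forall y, (\int[leb1]_x ((p \_ Omega) (x, y))%:E = (f2 y)%:E)%E}.
  rewrite /marginal2_eq; split.
    move=> /(ae_restr mO2 leb2E); apply: filterS2 f2E => y [Oy ->].
    by rewrite restrict_section2.
  move=> H; apply/(ae_restr mO2 leb2E); apply: filterS2 f2E H => y [Oy ->].
  by rewrite restrict_section2.
have sgn : {ae l, forall z, Omega z -> 0 <= p z} <-> {ae P, forall z, 0 <= (p \_ Omega) z}.
  split.
    move=> /(ae_restr measurable_Omega lebPE); apply: filterS2 cE => z [Oz _].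
    by rewrite restrictE.
  move=> H; apply/(ae_restr measurable_Omega lebPE); apply: filterS2 cE H => z [Oz _].
  by rewrite restrictE.
split.
  move=> [/(L2_sqintegrable lebPE) ? /m1 ? /m2 ? /sgn ?]; split => //; split => //.
move=> [? [/m1 ? /m2 ?] /sgn ?]; split => //; exact/(L2_sqintegrable lebPE).
Qed.

Lemma objective_restrict p : L2 l Omega p ->
  qrot_objective Omega1 Omega2 gamma c p = transport_cost leb1 leb2 gamma c' (p \_ Omega).
Proof.
move=> L2p; have [mp _] := (L2_sqintegrable lebPE p).1 L2p.
rewrite /qrot_objective /transport_cost (L2norm_sqr lebPE)//; congr (_ + _).
rewrite (Rintegral_restr lebPE).
have -> : (fun z => c z * p z) \_ Omega = (fun z => (c \_ Omega) z * (p \_ Omega) z).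
  by apply/funext => z; rewrite !patchE; case: ifPn => //; rewrite mulr0.
apply: ae_eq_Rint; first exact: measurable_funM.
  by apply: measurable_funM => //; exact: Lc'.1.
by apply: filterS cE => z [Oz ->]; rewrite restrictE.
Qed.

Variables (a1 a1' : 'rV[R]_d1 -> R) (a2 a2' : 'rV[R]_d2 -> R).
Hypotheses (ma1 : measurable_fun setT a1') (ma2 : measurable_fun setT a2').
Hypotheses (a1E : forall x, Omega1 x -> a1 x = a1' x).
Hypotheses (a2E : forall y, Omega2 y -> a2 y = a2' y).

Let g z := pos_part (oplus a1 a2 z - c z).
Let g' z := pos_part (oplus a1' a2' z - c' z).

Let gE : {ae P, forall z, (g \_ Omega) z = g' z}.
Proof.
apply: filterS cE => z [Oz cz]; have [zO1 zO2] := Oz; rewrite restrictE//.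
by rewrite /g /g' /oplus a1E// a2E// cz.
Qed.

Let mW : measurable_fun setT (oplus a1' a2').
Proof. by apply: measurable_funD; exact: measurableT_comp. Qed.

(** On [Omega], [g] is computed by the globally measurable [a1'], [a2'] and [c \_ Omega]. *)
Let mg : measurable_fun setT (g \_ Omega).
Proof.
have -> : g \_ Omega =
    (fun z => pos_part (oplus a1' a2' z - (c \_ Omega) z)) \_ Omega.
  apply/funext => z; rewrite !patchE; case: ifPn => // /set_mem [zO1 zO2].
  by rewrite /g /oplus a1E// a2E.
apply/(measurable_restrictT _ measurable_Omega).
apply: (measurable_funS measurableT (@subsetT _ _)).
by apply: measurable_maxr => //; exact: measurable_funB.
Qed.

Let mg' : measurable_fun setT g'.
Proof. by apply: measurable_maxr => //; apply: measurable_funB => //; exact: Lc'.1. Qed.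

(** The potentials [a1'] and [a2'] stand either for [a1] and [a2] themselves or for their extensions
    by zero, depending on the direction of the equivalence being proved. *)
Lemma dual_restrict1 :
  {ae l1, forall x, Omega1 x -> (\int[l2]_(y in Omega2)
     (pos_part (oplus a1 a2 (x, y) - c (x, y)))%:E = (gamma * mu1 x)%:E)%E} <->
  {ae leb1, forall x, (\int[leb2]_y
     (pos_part (oplus a1' a2' (x, y) - c' (x, y)))%:E = (gamma * f1 x)%:E)%E}.
Proof.
have K : {ae leb1, forall x, (\int[l2]_(y in Omega2) (g (x, y))%:E =
    \int[leb2]_y (g' (x, y))%:E)%E /\ f1 x = mu1 x}.
  apply: filterS2 f1E (ae_section1 gE) => x [Ox ->] gx; split => //.
  rewrite restrict_section1//; apply: ae_eq_integral => //.
  - by apply/measurable_EFinP; exact: measurable_section1.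
  - by apply/measurable_EFinP; exact: measurable_section1.
  - by apply: filterS gx => y ->.
split=> [/(ae_restr mO1 leb1E) H|H]; last apply/(ae_restr mO1 leb1E).
  by apply: filterS2 K H => x [<- ->].
by apply: filterS2 K H => x [-> ->].
Qed.

Lemma dual_restrict2 :
  {ae l2, forall y, Omega2 y -> (\int[l1]_(x in Omega1)
     (pos_part (oplus a1 a2 (x, y) - c (x, y)))%:E = (gamma * mu2 y)%:E)%E} <->
  {ae leb2, forall y, (\int[leb1]_x
     (pos_part (oplus a1' a2' (x, y) - c' (x, y)))%:E = (gamma * f2 y)%:E)%E}.
Proof.
have K : {ae leb2, forall y, (\int[l1]_(x in Omega1) (g (x, y))%:E =
    \int[leb1]_x (g' (x, y))%:E)%E /\ f2 y = mu2 y}.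
  apply: filterS2 f2E (ae_section2 gE) => y [Oy ->] gy; split => //.
  rewrite restrict_section2//; apply: ae_eq_integral => //.
  - by apply/measurable_EFinP; exact: measurable_section2.
  - by apply/measurable_EFinP; exact: measurable_section2.
  - by apply: filterS gy => x ->.
split=> [/(ae_restr mO2 leb2E) H|H]; last apply/(ae_restr mO2 leb2E).
  by apply: filterS2 K H => y [<- ->].
by apply: filterS2 K H => y [-> ->].
Qed.

Lemma plan_restrict p :
  {ae l, forall z, Omega z ->
     p z - gamma^-1 * pos_part (oplus a1 a2 z - c z) = 0} <->
  {ae P, forall z, (p \_ Omega) z =
     gamma^-1 * pos_part (oplus a1' a2' z - c' z)}.
Proof.
split=> [/(ae_restr measurable_Omega lebPE) H|H].
  apply: filterS3 cE gE H => z [Oz _]; rewrite !restrictE// => gz /eqP.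
  by rewrite subr_eq0 => /eqP ->; congr (_ * _).
apply/(ae_restr measurable_Omega lebPE).
apply: filterS3 cE gE H => z [Oz _]; rewrite !restrictE// => gz ->.
by apply/eqP; rewrite subr_eq0; apply/eqP; congr (_ * _).
Qed.

End restricted_transport.

Theorem theorem2p11 (R : realType) (d1 d2 : nat)
  (Omega1 : set 'rV[R]_d1) (Omega2 : set 'rV[R]_d2)
  (hOmega1 : compact_domain Omega1) (hOmega2 : compact_domain Omega2)
  (gamma : R) (gamma_gt0 : 0 < gamma)
  (c : 'rV[R]_d1 * 'rV[R]_d2 -> R)
  (hc : L2 (lebesgue_prod R d1 d2) (Omega1 `*` Omega2) c)
  (c_low : R)
  (hc_low : {ae lebesgue_prod R d1 d2, forall x,
    (Omega1 `*` Omega2) x -> c_low <= c x})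
  (mu1 : 'rV[R]_d1 -> R) (mu2 : 'rV[R]_d2 -> R)
  (hmu1 : L2 (lebesgue_rV R d1) Omega1 mu1)
  (hmu2 : L2 (lebesgue_rV R d2) Omega2 mu2)
  (delta : R) (delta_gt0 : 0 < delta)
  (mu1_ge : {ae lebesgue_rV R d1, forall x1, Omega1 x1 -> delta <= mu1 x1})
  (mu2_ge : {ae lebesgue_rV R d2, forall x2, Omega2 x2 -> delta <= mu2 x2})
  (mu1_int : (\int[lebesgue_rV R d1]_(x1 in Omega1) (mu1 x1)%:E = 1)%E)
  (mu2_int : (\int[lebesgue_rV R d2]_(x2 in Omega2) (mu2 x2)%:E = 1)%E)
  (pi_star : 'rV[R]_d1 * 'rV[R]_d2 -> R)
  (hpi_star : L2 (lebesgue_prod R d1 d2) (Omega1 `*` Omega2) pi_star) :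
  qrot_solution Omega1 Omega2 gamma c mu1 mu2 pi_star <->
  exists (alpha1 : 'rV[R]_d1 -> R) (alpha2 : 'rV[R]_d2 -> R),
    [/\ L2 (lebesgue_rV R d1) Omega1 alpha1,
        L2 (lebesgue_rV R d2) Omega2 alpha2,
        {ae lebesgue_prod R d1 d2, forall x, (Omega1 `*` Omega2) x ->
          pi_star x - gamma^-1 * pos_part (oplus alpha1 alpha2 x - c x) = 0},
        {ae lebesgue_rV R d1, forall x1, Omega1 x1 ->
          (\int[lebesgue_rV R d2]_(x2 in Omega2)
             (pos_part (oplus alpha1 alpha2 (x1, x2) - c (x1, x2)))%:E
           = (gamma * mu1 x1)%:E)%E} &
        {ae lebesgue_rV R d2, forall x2, Omega2 x2 ->
          (\int[lebesgue_rV R d1]_(x1 in Omega1)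
             (pos_part (oplus alpha1 alpha2 (x1, x2) - c (x1, x2)))%:E
           = (gamma * mu2 x2)%:E)%E}].
Proof.
have mO1 := compact_rV_measurable hOmega1.1.
have mO2 := compact_rV_measurable hOmega2.1.
have fO1 := compact_rV_finite hOmega1.1.
have fO2 := compact_rV_finite hOmega2.1.
pose m1 := leb1 mO1 fO1; pose m2 := leb2 mO2 fO2.
pose Omega := Omega1 `*` Omega2.
have mO : measurable Omega := measurable_Omega mO1 mO2.
have m1E := leb1E mO1 fO1; have m2E := leb2E mO2 fO2.
have PE := lebPE mO1 mO2 fO1 fO2.
(* Versions of the data that satisfy the lower bounds everywhere. *)
pose c' z := Num.max ((c \_ Omega) z) c_low.
pose f1 x := Num.max ((mu1 \_ Omega1) x) delta.
pose f2 y := Num.max ((mu2 \_ Omega2) y) delta.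
have [cE Lc'] : {ae (m1 \x m2)%E, forall z, Omega z /\ c' z = c z} /\
    sqintegrable (m1 \x m2)%E c' := sqintegrable_max_restr mO PE hc hc_low.
have [f1E Lf1] : {ae m1, forall x, Omega1 x /\ f1 x = mu1 x} /\
    sqintegrable m1 f1 := sqintegrable_max_restr mO1 m1E hmu1 mu1_ge.
have [f2E Lf2] : {ae m2, forall y, Omega2 y /\ f2 y = mu2 y} /\
    sqintegrable m2 f2 := sqintegrable_max_restr mO2 m2E hmu2 mu2_ge.
have mc := ((L2_sqintegrable PE c).1 hc).1.
have f1_int : \int[m1]_x f1 x = 1.
  have <- : \int[m1]_x (mu1 \_ Omega1) x = 1.
    by rewrite -(Rintegral_restr m1E) /Rintegral mu1_int.
  apply: ae_eq_Rint; [exact: Lf1.1|exact: ((L2_sqintegrable m1E mu1).1 hmu1).1|].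
  by apply: filterS f1E => x [Ox ->]; rewrite restrictE.
have f2_int : \int[m2]_x f2 x = 1.
  have <- : \int[m2]_x (mu2 \_ Omega2) x = 1.
    by rewrite -(Rintegral_restr m2E) /Rintegral mu2_int.
  apply: ae_eq_Rint; [exact: Lf2.1|exact: ((L2_sqintegrable m2E mu2).1 hmu2).1|].
  by apply: filterS f2E => x [Ox ->]; rewrite restrictE.
have f1_ge x : delta <= f1 x by rewrite le_max lexx orbT.
have f2_ge y : delta <= f2 y by rewrite le_max lexx orbT.
have c_ge z : c_low <= c' z by rewrite le_max lexx orbT.
have mp := ((L2_sqintegrable PE pi_star).1 hpi_star).1.
have opt := transport_optimality gamma_gt0 delta_gt0 Lc' Lf1 Lf2 f1_ge f2_ge c_ge
  f1_int f2_int mp.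
have feas := feasible_restrict cE f1E f2E.
have obj := objective_restrict mc Lc' cE gamma.
have sol : qrot_solution Omega1 Omega2 gamma c mu1 mu2 pi_star <->
    transport_plan m1 m2 f1 f2 (pi_star \_ Omega) /\
    forall q, transport_plan m1 m2 f1 f2 q ->
     transport_cost m1 m2 gamma c' (pi_star \_ Omega) <= transport_cost m1 m2 gamma c' q.
  split=> -[/feas Tp p_min].
    split => // q Tq; have [[mq _] _ _] := Tq.
    (* A competitor on the finite measure spaces is exchanged for its restriction to [Omega], equal
       to it a.e., so that it can compete in the original problem. *)
    have qE : {ae (m1 \x m2)%E, forall z, q z = (q \_ Omega) z}.
      by apply: filterS cE => z [Oz _]; rewrite restrictE.
    have mqO : measurable_fun setT (q \_ Omega).
      apply/(measurable_restrictT _ mO).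
      exact: (measurable_funS measurableT (@subsetT _ _)).
    have Fq : qrot_feasible Omega1 Omega2 mu1 mu2 q.
      by apply/feas; exact: transport_plan_ae mqO qE Tq.
    rewrite (transport_cost_ae gamma Lc' mq mqO qE) -!obj//; first exact: p_min.
    by case: Fq.
  split => // q Fq; have [L2q _ _ _] := Fq.
  by rewrite !obj//; apply: p_min; apply/feas.
rewrite sol opt; split.
  move=> [a1 [a2 [[L1 L2 eq1 eq2] pE]]]; exists a1, a2.
  have [m1a m2a] := (L1.1, L2.1).
  split.
  - apply/(L2_sqintegrable m1E); apply: ae_sqintegrable L1.
      apply/(measurable_restrictT _ mO1).
      exact: (measurable_funS measurableT (@subsetT _ _)).
    by apply: filterS f1E => x [Ox _]; rewrite restrictE.
  - apply/(L2_sqintegrable m2E); apply: ae_sqintegrable L2.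
      apply/(measurable_restrictT _ mO2).
      exact: (measurable_funS measurableT (@subsetT _ _)).
    by apply: filterS f2E => x [Ox _]; rewrite restrictE.
  - exact/(plan_restrict cE gamma (fun _ _ => erefl) (fun _ _ => erefl)).
  - exact/(dual_restrict1 mc Lc' cE f1E gamma m1a m2a (fun _ _ => erefl) (fun _ _ => erefl)).
  - exact/(dual_restrict2 mc Lc' cE f2E gamma m1a m2a (fun _ _ => erefl) (fun _ _ => erefl)).
(* These potentials are only controlled on the domains, so their globally measurable extensions by
   zero are used. *)
move=> [a1 [a2 [/(L2_sqintegrable m1E) L1 /(L2_sqintegrable m2E) L2 pE eq1 eq2]]].
have a1E x : Omega1 x -> a1 x = (a1 \_ Omega1) x by move=> Ox; rewrite restrictE.
have a2E y : Omega2 y -> a2 y = (a2 \_ Omega2) y by move=> Oy; rewrite restrictE.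
exists (a1 \_ Omega1), (a2 \_ Omega2); split; last first.
  exact/(plan_restrict cE gamma a1E a2E).
split => //.
- exact/(dual_restrict1 mc Lc' cE f1E gamma L1.1 L2.1 a1E a2E).
- exact/(dual_restrict2 mc Lc' cE f2E gamma L1.1 L2.1 a1E a2E).
Qed.
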